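(* Let $f \in \mathrm{Homeo}^+([0,1])$. The conjugacy class of $f$ in $\mathrm{Homeo}^+([0,1])$ is non-Haar null if and only if $\mathrm{Fix}(f)$ has no limit point in the open interval $(0,1)$, and for every $x_0 \in \mathrm{Fix}(f)\cap(0,1)$ the function $x \mapsto f(x)-x$ does not have a local extremum point at $x_0$. Moreover, the union of the non-Haar null conjugacy classes of $\mathrm{Homeo}^+([0,1])$ is co-Haar null.
   Context: $\mathrm{Homeo}^+([0,1])$ is the Polish group (under composition) of increasing homeomorphisms of $[0,1]$ with the topology of uniform convergence. $\mathrm{Fix}(f)=\{x\in[0,1]: f(x)=x\}$. Haar null sets (Christensen): in a Polish group $G$, a Borel set $B\subset G$ is Haar null if there is a Borel probability measure $\mu$ on $G$ such that $\mu(gBh)=0$ for all $g,h\in G$; an arbitrary set $S \subset G$ is Haar null if it is contained in a Borel Haar null set; a set is non-Haar null if it is not Haar null, and co-Haar null if its complement is Haar null. *)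

(* Defs.v *)
From HB Require Import structures.
From mathcomp Require Import all_boot all_order all_algebra.
From mathcomp Require Import all_classical all_reals all_analysis.
Set Implicit Arguments.
Unset Strict Implicit.
Unset Printing Implicit Defensive.

Import Order.TTheory GRing.Theory Num.Theory.
Import numFieldNormedType.Exports.

Local Open Scope classical_set_scope.
Local Open Scope ring_scope.

HB.mixin Record isTopologicalGroup G & Topological G & Group G := {
  mulg_continuous : continuous (fun x : G * G => (x.1 * x.2)%g) ;
  invg_continuous : continuous (fun x : G => (x^-1)%g)
}.

(* [Pointed] is required by [g_sigma_algebraType]; its value is irrelevant. *)
#[short(type="topologicalGroupType")]
HB.structure Definition TopologicalGroup :=
  {G of Topological G & Pointed G & Group G & isTopologicalGroup G}.

Section haar_null.
Variables (R : realType) (G : topologicalGroupType).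

Definition borel_set : set (set G) := <<s @open G >>.

Definition borel_probability := probability (g_sigma_algebraType (@open G)) R.

Definition translate (g h : G) (B : set G) : set G :=
  [set (g * b * h)%g | b in B].

(* The values of a measure outside the sigma-algebra carry no information, but
   translates of Borel sets are Borel since translations are homeomorphisms. *)
Definition borel_haar_null (B : set G) : Prop :=
  borel_set B /\
  exists mu : borel_probability, forall g h : G, mu (translate g h B) = 0%E.

Definition haar_null (S : set G) : Prop :=
  exists2 B : set G, borel_haar_null B & S `<=` B.

Definition co_haar_null (S : set G) : Prop := haar_null (~` S).

End haar_null.

Definition conj_class (G : groupType) (f : G) : set G :=
  [set (g * f * g^-1)%g | g in [set: G]].

(* Non-strict extrema; for x |-> f x - x at an isolated fixed point of f,
   strict and non-strict extrema are the same. *)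
Definition local_extremum (T : topologicalType) (R : realType)
    (h : T -> R) (x0 : T) : Prop :=
  (\forall x \near x0, h x <= h x0) \/ (\forall x \near x0, h x0 <= h x).

Notation unit_interval R := (set_type (`[0 : R, 1]%classic)).

Section homeo.
Variable R : realType.
Local Notation I := (unit_interval R).

Definition increasing_homeo : set {uniform I -> I} :=
  [set f : I -> I | [/\ continuous f,
    exists g : I -> I, [/\ cancel f g, cancel g f & continuous g] &
    {homo f : x y / val x < val y}]].

(* A subtype of the functions with the topology of uniform convergence, from
   which it inherits its own topology. *)
Definition homeo : Type := set_type increasing_homeo.

HB.instance Definition _ := Uniform.on homeo.

Definition homeo_fun (f : homeo) : I -> I := val f.
Local Coercion homeo_fun : homeo >-> Funclass.

Lemma homeoP (f : homeo) : increasing_homeo f.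
Proof. exact: (set_valP f). Qed.

Lemma eq_homeo (f g : homeo) : f =1 g -> f = g.
Proof. by move=> fg; apply: val_inj; apply: funext. Qed.

Lemma increasing_homeo_id : increasing_homeo idfun.
Proof.
have cid : continuous (idfun : I -> I) by move=> x; exact: cvg_id.
by split=> //; exists idfun; split.
Qed.

Lemma increasing_homeo_comp (f g : I -> I) :
  increasing_homeo f -> increasing_homeo g -> increasing_homeo (f \o g).
Proof.
move=> [cf [f' [fK f'K cf']] mf] [cg [g' [gK g'K cg']] mg]; split.
- by move=> x; apply: (@continuous_comp _ _ _ g f) (cg x) (cf _).
- exists (g' \o f'); split; [exact: can_comp|exact: can_comp|].
  by move=> x; apply: (@continuous_comp _ _ _ f' g') (cf' x) (cg' _).
- by move=> x y /mg/mf.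
Qed.

Lemma increasing_homeo_inv (f g : I -> I) :
  increasing_homeo f -> cancel f g -> cancel g f -> increasing_homeo g.
Proof.
move=> [cf [f' [fK f'K cf']] mf] fg gf.
have <- : f' = g by apply: funext => x; rewrite -[in LHS](gf x) fK.
split=> //; first by exists f.
move=> x y xy; rewrite ltNge; apply/negP; rewrite le_eqVlt => /orP[/eqP|].
  by move/val_inj => e; move: xy; rewrite -[x]f'K -[y]f'K e ltxx.
by move=> /mf; rewrite !f'K => /lt_trans/(_ xy); rewrite ltxx.
Qed.

Definition homeo1 : homeo := SigSub (mem_set increasing_homeo_id).

Definition homeo_mul (f g : homeo) : homeo :=
  SigSub (mem_set (increasing_homeo_comp (homeoP f) (homeoP g))).

Lemma homeo_inv_subproof (f : homeo) :
  exists g : homeo, cancel f g /\ cancel g f.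
Proof.
have [_ [g [fK gK _]] _] := homeoP f.
by exists (SigSub (mem_set (increasing_homeo_inv (homeoP f) fK gK))).
Qed.

Definition homeo_inv (f : homeo) : homeo := projT1 (cid (homeo_inv_subproof f)).

Lemma homeoK (f : homeo) : cancel f (homeo_inv f).
Proof. by rewrite /homeo_inv; case: cid => g []. Qed.

Lemma homeoVK (f : homeo) : cancel (homeo_inv f) f.
Proof. by rewrite /homeo_inv; case: cid => g []. Qed.

Lemma homeo_mulA : associative homeo_mul.
Proof. by move=> f g h; apply: eq_homeo => x. Qed.

Lemma homeo_mul1g : left_id homeo1 homeo_mul.
Proof. by move=> f; apply: eq_homeo => x. Qed.

Lemma homeo_mulg1 : right_id homeo1 homeo_mul.
Proof. by move=> f; apply: eq_homeo => x. Qed.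

Lemma homeo_mulVg : left_inverse homeo1 homeo_inv homeo_mul.
Proof. by move=> f; apply: eq_homeo; exact: homeoK. Qed.

Lemma homeo_mulgV : right_inverse homeo1 homeo_inv homeo_mul.
Proof. by move=> f; apply: eq_homeo; exact: homeoVK. Qed.

HB.instance Definition _ := isGroup.Build homeo
  homeo_mulA homeo_mul1g homeo_mulg1 homeo_mulVg homeo_mulgV.
HB.instance Definition _ := isPointed.Build homeo homeo1.

Lemma compact_unit_interval : compact [set: I].
Proof.
move=> F FF _.
have FI : (val @ F) `[0 : R, 1]%classic.
  by apply: nearW => x; exact: (set_valP x).
have [x [xI Fx]] := @segment_compact R 0 1 (val @ F) _ FI.
exists (SigSub (mem_set xI)); split=> // A B FA [_ [[C oC <-] Cx] CB].
have [|y [[z Az <-] Cz]] := Fx (val @` A) C _ (open_nbhs_nbhs (conj oC Cx)).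
  by apply: (@filterS _ F _ A) FA => z Az; exists z.
by exists z; split=> //; exact: CB.
Qed.

Lemma homeo_unif_continuous (f : homeo) (e : R) : 0 < e ->
  \forall d \near 0^'+, forall x y : I, ball x d y -> ball (f x) e (f y).
Proof.
move=> e0; have [cf _ _] := homeoP f.
have := (compact_near_coveringP _).1 compact_unit_interval R 0^'+
  (fun d x => forall y : I, ball x d y -> ball (f x) e (f y)) _.
move=> H; near=> d => x; move: x (Logic.I : setT x); near: d; apply: H => x _.
have /cvg_ballP/(_ (e / 2)) := cf x.
rewrite divr_gt0// => /(_ isT) /nbhs_ballP[d /= d0 xd].
have d20 : 0 < d / 2 by rewrite divr_gt0.
near=> z d'.
have xz : ball x (d / 2) z by near: z; exact: nbhsx_ballx.
have d'd : d' <= d / 2 by near: d'; exact: nbhs_right_le.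
move=> y /(le_ball d'd) zy; apply: (@ball_split _ _ (f x)).
  apply: ball_sym; apply: xd; apply: le_ball xz.
  by rewrite ler_pdivrMr// ler_peMr ?ltW// ltr1n.
by apply: xd; exact: ball_split zy.
Unshelve. all: by end_near. Qed.

Lemma nbhs_homeo (f : homeo) (P : set homeo) :
  nbhs f P <-> exists2 e : R, 0 < e &
    [set g : homeo | forall x, ball (f x) e (g x)] `<=` P.
Proof.
split=> [[_ [[C oC <-] Cf] CP]|[e e0 eP]].
  have /uniform_nbhs[E [/= + EC]] := open_nbhs_nbhs (conj oC Cf).
  rewrite -entourage_ballE => -[e /= e0 eE]; exists e => // g fg.
  by apply: CP; apply: EC => y _; apply: eE; exact: fg.
have : nbhs (val f) [set g : {uniform I -> I} | forall x, ball (f x) e (g x)].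
  apply/uniform_nbhs; exists [set xy | ball xy.1 e xy.2]; split.
    exact: entourage_ball (PosNum e0).
  by move=> g /= fg x; exact: fg.
have cval : continuous (val : homeo -> {uniform I -> I}).
  exact: (@initial_continuous homeo {uniform I -> I} val).
move=> /(cval f); apply: (@filterS homeo (nbhs f)) => g; exact: eP.
Qed.

Lemma homeo_mul_continuous :
  continuous (fun x : homeo * homeo => (x.1 * x.2)%g).
Proof.
suff mul_cvg (f g : homeo) :
    (x.1 * x.2)%g @[x --> (f, g)] --> (f * g)%g by case; exact: mul_cvg.
move=> P /nbhs_homeo[e e0 eP].
have e20 : 0 < e / 2 by rewrite divr_gt0.
have [d [d0 fd]] : exists d, 0 < d /\
    forall x y : I, ball x d y -> ball (f x) (e / 2) (f y).
  have /filter_ex[d [? ?]] : \forall d \near 0^'+, 0 < d /\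
      forall x y : I, ball x d y -> ball (f x) (e / 2) (f y).
    by near=> d; split=> //; near: d; exact: homeo_unif_continuous.
  by exists d.
exists ([set f' : homeo | forall x, ball (f x) (e / 2) (f' x)],
        [set g' : homeo | forall x, ball (g x) d (g' x)]).
  by split; apply/nbhs_homeo; [exists (e / 2)|exists d].
move=> [f' g'] /= [ff' gg']; apply: eP => x.
by apply: (@ball_split _ _ (f (g' x))); [exact: fd|exact: ff'].
Unshelve. all: by end_near. Qed.

Lemma homeo_inv_continuous : continuous (fun x : homeo => (x^-1)%g).
Proof.
move=> f P /nbhs_homeo[e e0 eP].
have [d [d0 fd]] : exists d, 0 < d /\
    forall x y : I, ball x d y -> ball (homeo_inv f x) e (homeo_inv f y).
  have /filter_ex[d [? ?]] : \forall d \near 0^'+, 0 < d /\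
      forall x y : I, ball x d y -> ball (homeo_inv f x) e (homeo_inv f y).
    by near=> d; split=> //; near: d; exact: homeo_unif_continuous.
  by exists d.
apply/nbhs_homeo; exists d => // g fg; apply: eP => x.
rewrite -[X in ball _ _ X](homeoK f); apply: fd.
by apply: ball_sym; rewrite -[X in ball _ _ X](homeoVK g); exact: fg.
Unshelve. all: by end_near. Qed.

HB.instance Definition _ := isTopologicalGroup.Build homeo
  homeo_mul_continuous homeo_inv_continuous.

Definition Fix (f : homeo) : set I := [set x | f x = x].

End homeo.

Coercion homeo_fun : homeo >-> Funclass.

(* Main.v *)
Require Import Defs.
From HB Require Import structures.
From mathcomp Require Import all_boot all_order all_algebra.
From mathcomp Require Import all_classical all_reals all_analysis.
From mathcomp Require Import measurable_realfun.
From mathcomp Require Import ring lra zify.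
Set Implicit Arguments.
Unset Strict Implicit.
Unset Printing Implicit Defensive.

Import Order.TTheory GRing.Theory Num.Theory.
Import numFieldNormedType.Exports.

Local Open Scope classical_set_scope.
Local Open Scope ring_scope.

(* The logistic chart turns homeomorphisms of [0, 1] into increasing bijections
   of the line.

   Let k_t be the translation by t, with t uniform in [0, 1].  Then g k_t h fixes
   x iff g^-1 x - h x = t.  The difference of two increasing functions has locally
   finite level sets at almost every level (Banach's indicatrix), and only one
   level can be its maximum (or minimum) over a given rational interval.  Hence
   the homeomorphisms whose fixed points accumulate, or which touch the identity
   without crossing it, form a Haar null set.

   Two of the remaining homeomorphisms with the same sequence of signs are
   conjugate.  So, given such an f and an arbitrary Borel probability measure, it
   suffices to find p and q such that q k p has the signs of f with positive
   probability in k.  After normalization k stays, with high probability, within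
   bounded distance of the identity of the line.  Its graph is then compared with
   a curve that runs below or above this strip according to the signs of f, and
   traverses the strip by very flat or very steep affine pieces.  Banach's
   indicatrix, averaged over the offset of each piece, shows that every traversal
   crosses the graph of k exactly once with probability close to 1. *)

(** * Increasing bijections of the line *)

Section increasing_bijections.
Variable R : realType.
Implicit Types (f g h c : R -> R) (x y z : R).

(** The law of k is given before p and q, and only monotonicity of k is known, so no derivative can
    force a single crossing. A traversal meets the graph where a difference of two increasing
    functions takes a prescribed value. A flat line is slowly varying itself; a steep line is slowly
    varying as a function of the height. Both are needed because the curve must be increasing: it
    gets below the strip by waiting and above it by climbing fast.

    Infinitely many crossings may be prescribed, so the failure probabilities of the traversals form
    a geometric series. The ends of the interval are at infinity in the chart, and fixed points may
    accumulate there; hence the signs are indexed by all integers, and finitely many fixed points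
    correspond to constant tails. *)

Definition incbij f := {homo f : x y / x < y} /\ (forall y, exists x, f x = y).

Lemma incbij_lt f : incbij f -> {mono f : x y / x < y}.
Proof. by move=> [fm _]; apply: leW_mono; exact: le_mono. Qed.

Lemma incbij_le f : incbij f -> {mono f : x y / x <= y}.
Proof. by move=> [fm _]; exact: le_mono. Qed.

Lemma incbij_inj f : incbij f -> injective f.
Proof.
move=> bf x y e; apply/eqP; rewrite eq_le.
by rewrite -(incbij_le bf) -[y <= x](incbij_le bf) e lexx.
Qed.

Lemma incbij_inv f : incbij f ->
  exists g, [/\ incbij g, cancel f g & cancel g f].
Proof.
move=> bf; have [g fg] := choice bf.2.
have gf : cancel f g by move=> x; apply: (incbij_inj bf); rewrite fg.
exists g; split=> //; split; last by move=> y; exists (f y).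
by move=> x y xy; rewrite -(incbij_lt bf) !fg.
Qed.

Lemma incbij_id : incbij id.
Proof. by split=> // y; exists y. Qed.

Lemma incbij_comp f g : incbij f -> incbij g -> incbij (f \o g).
Proof.
move=> [fm fs] [gm gs]; split; first by move=> x y /gm/fm.
by move=> y; have [z <-] := fs y; have [x <-] := gs z; exists x.
Qed.

Lemma incbij_opp f : incbij f -> incbij (fun x => - f (- x)).
Proof.
move=> bf; split; first by move=> x y xy; rewrite ltrN2 (incbij_lt bf) ltrN2.
by move=> y; have [x xE] := bf.2 (- y); exists (- x); rewrite opprK xE opprK.
Qed.

Lemma incbij_continuous f : incbij f -> continuous f.
Proof.
move=> bf x; apply/cvgrPdist_lt => e e0.
have [a fa] := bf.2 (f x - e); have [b fb] := bf.2 (f x + e).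
have ax : a < x by rewrite -(incbij_lt bf) fa ltrBlDr ltrDl.
have xb : x < b by rewrite -(incbij_lt bf) fb ltrDl.
near=> z.
have az : a < z by near: z; exact: lt_nbhsr.
have zb : z < b by near: z; exact: lt_nbhsl.
move: az zb; rewrite -(incbij_lt bf) -[z < b](incbij_lt bf) fa fb => az zb.
by rewrite ltr_distlC -ltrBlDr; apply/andP; split; lra.
Unshelve. all: by end_near. Qed.

Definition conjugate f g :=
  exists c, incbij c /\ forall x, c (f x) = g (c x).

Lemma conjugate_trans f g h :
  conjugate f g -> conjugate g h -> conjugate f h.
Proof.
move=> [c [bc cf]] [d [bd dg]]; exists (d \o c).
by split=> [|x /=]; [exact: incbij_comp|rewrite cf dg].
Qed.

Lemma conjugate_sym f g : conjugate f g -> conjugate g f.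
Proof.
move=> [c [bc cf]]; have [d [bd cK dK]] := incbij_inv bc.
by exists d; split=> // x; rewrite -{1}[x]dK -cf cK.
Qed.

Lemma int_cross (a : int -> R) (i : int) (n : nat) y :
  a i <= y -> y < a (i + n%:Z) -> exists j, a j <= y < a (j + 1).
Proof.
elim: n => [|n IH] ai yn; first by move: yn; rewrite addr0 ltNge ai.
have [yn'|yn'] := ltP y (a (i + n%:Z)); first exact: IH.
by exists (i + n%:Z); rewrite yn' -addrA [_ + 1 in X in a X]addrC -intS.
Qed.

Lemma int_mono (a : int -> R) : (forall i, a i < a (i + 1)) ->
  {mono a : i j / i < j}.
Proof.
move=> ai; apply/leW_mono/le_mono => i j ij.
have -> : j = i + 1 + (absz (j - i - 1)%R)%:Z by lia.
elim: (absz _) => [|n IH]; first by rewrite addr0.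
have -> : i + 1 + n.+1%:Z = i + 1 + n%:Z + 1 by lia.
exact: lt_trans IH (ai _).
Qed.

Lemma glue_homo g : (forall (i : int) x y,
    i%:~R <= x -> x < y -> y <= (i + 1)%:~R -> g x < g y) ->
  {homo g : x y / x < y}.
Proof.
move=> H x y xy.
have /andP[lx _] := floor_itv x; set i := Num.floor x in lx.
have [n yn] : exists n : nat, y <= (i + n%:Z)%:~R.
  have /andP[ly ry] := floor_itv y.
  exists (absz (Num.floor y + 1 - i)%R); apply: (le_trans (ltW ry)); rewrite ler_int.
  have absI (k l : int) : k <= l + (absz (k - l)%R)%:Z by lia.
  exact: absI.
elim: n y xy yn => [|n IH] y xy yn.
  by rewrite addr0 in yn; move: (lt_le_trans xy yn); rewrite ltNge lx.
have iS : (i + n.+1%:Z) = (i + n%:Z + 1) by lia.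
have [yn'|yn'] := leP y (i + n%:Z)%:~R; first exact: IH.
rewrite iS in yn.
case: n {iS} IH yn yn' => [|n] IH yn yn'.
  by rewrite addr0 in yn; exact: (H i).
have xn : x < (i + n.+1%:Z)%:~R.
  have /andP[_ rx] := floor_itv x; apply: (lt_le_trans rx).
  by rewrite ler_int lerD2l.
by apply: (lt_trans (IH _ xn (lexx _))); apply: H yn => //; exact: lexx.
Qed.

Lemma glue_incbij g : (forall (i : int) x y,
    i%:~R <= x -> x < y -> y <= (i + 1)%:~R -> g x < g y) ->
  (forall (i : int) y, g i%:~R <= y -> y <= g (i + 1)%:~R ->
    exists x, g x = y) ->
  (forall y, exists i : int, g i%:~R <= y) ->
  (forall y, exists i : int, y <= g i%:~R) -> incbij g.
Proof.
move=> H Hs Hl Hr; have gm := glue_homo H; split=> // y.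
have [i iy] := Hl y; have [j yj] := Hr (y + 1).
have ym : y < g (i + (absz (j - i)%R)%:Z)%:~R.
  have [ij|ji] := leP i j.
    have -> : i + (absz (j - i)%R)%:Z = j by lia.
    by apply: lt_le_trans yj; rewrite ltrDl.
  have : g j%:~R < g i%:~R by apply: gm; rewrite ltr_int.
  by move=> ?; exfalso; lra.
have [k /andP[k1 k2]] := int_cross (a := fun i => g i%:~R) iy ym.
exact: (Hs k y k1 (ltW k2)).
Qed.

Definition bi_unbounded (a : int -> R) :=
  [/\ forall i, a i < a (i + 1), forall y, exists i, a i <= y &
      forall y, exists i, y <= a i].

Lemma interpolate (a : int -> R) : bi_unbounded a ->
  exists p, incbij p /\ forall i : int, p i%:~R = a i.
Proof.
move=> [aS al ar].
pose p x := a (Num.floor x) + (x - (Num.floor x)%:~R) *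
  (a (Num.floor x + 1) - a (Num.floor x)).
(* At the right end of a cell its formula agrees with that of the next cell, so closed cells are
   allowed. *)
have pE (i : int) x : i%:~R <= x <= (i + 1)%:~R ->
    p x = a i + (x - i%:~R) * (a (i + 1) - a i).
  move=> /andP[ix]; rewrite le_eqVlt => /orP[/eqP->|xi].
    by rewrite /p intrKfloor; rewrite intrD subrr; ring.
  by rewrite /p (floor_def (m := i)) ?ix.
have pi (i : int) : p i%:~R = a i by rewrite /p intrKfloor subrr mul0r addr0.
exists p; split=> //; apply: glue_incbij => [i x y ix xy yi|i y iy yi|y|y].
- rewrite (pE i x) ?ix ?(le_trans (ltW xy) yi)//.
  rewrite (pE i y) ?yi ?(le_trans ix (ltW xy))//.
  by rewrite ltrD2l ltr_pM2r ?subr_gt0 ?aS// ltrD2r.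
- move: iy yi; rewrite !pi => iy yi; have d0 : 0 < a (i + 1) - a i.
    by rewrite subr_gt0.
  exists (i%:~R + (y - a i) / (a (i + 1) - a i)).
  rewrite (pE i).
    by rewrite addrAC subrr add0r divfK ?gt_eqF// addrC subrK.
  rewrite lerDl divr_ge0 ?subr_ge0 ?(ltW (aS i))//=
    intrD lerD2l ler_pdivrMr//.
  by rewrite mul1r lerD2r.
- by have [i] := al y; exists i; rewrite pi.
- by have [i] := ar y; exists i; rewrite pi.
Qed.

End increasing_bijections.

(** * Conjugacy *)

Section conjugacy.
Variable R : realType.
Implicit Types (f g h c : R -> R) (x y z w : R).

Definition iterz f g (n : int) : R -> R :=
  match n with Posz k => iter k f | Negz k => iter k.+1 g end.

Lemma iterzS f g : cancel f g -> cancel g f ->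
  forall n x, iterz f g (n + 1) x = f (iterz f g n x).
Proof.
move=> fK gK [n|[|n]] x; first by rewrite -PoszD addn1.
  by rewrite /= gK.
have -> : Negz n.+1 + 1 = Negz n by lia.
by rewrite /= gK.
Qed.

Lemma incbij_iter f n : incbij f -> incbij (iter n f).
Proof.
move=> bf; elim: n => [|n IH]; first exact: incbij_id.
by have := incbij_comp bf IH.
Qed.

Lemma incbij_iterz f g n : incbij f -> incbij g -> incbij (iterz f g n).
Proof. by move=> bf bg; case: n => n; exact: incbij_iter. Qed.

(** A bounded increasing orbit converges to its supremum, which is a fixed point. *)
Lemma iter_escape f w x : incbij f -> w < f w -> w <= x ->
  (forall z, w <= z <= x -> f z <> z) -> exists n, x < iter n f w.
Proof.
move=> bf wf wx H; apply: contrapT => /forallNP Hn.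
have iS n : iter n f w < iter n.+1 f w.
  by rewrite iterSr (incbij_lt (incbij_iter n bf)).
pose S := range (fun n => iter n f w); pose s := sup S.
have Sub : ubound S x by move=> _ [n _ <-]; rewrite leNgt; apply/negP/Hn.
have S0 : S !=set0 by exists w, 0%N.
have hS : has_sup S by split => //; exists x.
have Ss n : iter n f w <= s by apply: (ub_le_sup hS.2); exists n.
have sx : s <= x by apply: ge_sup.
apply: (H s); first by rewrite sx andbT (Ss 0%N).
(* Continuity enters as surjectivity: [r] is the preimage of the supremum. If [s < f s], then
   [r < s], some iterate exceeds [r], and the next one exceeds [s]. *)
have [r fr] := bf.2 s.
apply/eqP; rewrite eq_le; apply/andP; split.
- rewrite leNgt; apply/negP; rewrite -{1}fr (incbij_lt bf) => rs.
  have rs0 : 0 < s - r by rewrite subr_gt0.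
  have [_ [n _ <-]] := sup_adherent rs0 hS; rewrite subKr => rn.
  by have := Ss n.+1; rewrite iterS -fr (incbij_le bf) leNgt rn.
- apply: ge_sup => // _ [n _ <-]; apply: (le_trans (ltW (iS n))).
  by rewrite iterS (incbij_le bf).
Qed.

(** On the complement of the fixed points this is the relation of lying in the same component,
    whatever the order of [x] and [y]. *)
Definition fixed_free f x y :=
  forall z, (x <= z <= y) || (y <= z <= x) -> f z <> z.

Lemma fixed_freexx f x : f x <> x -> fixed_free f x x.
Proof. by move=> fx z; rewrite orbb -eq_le => /eqP <-. Qed.

Lemma fixed_freeWr f x y : fixed_free f x y -> f y <> y.
Proof. by apply; rewrite lexx /= andbT le_total. Qed.

Lemma fixed_free_sym f x y : fixed_free f x y -> fixed_free f y x.
Proof. by move=> H z; rewrite orbC => /H. Qed.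

Lemma fixed_free_trans f x y z :
  fixed_free f x y -> fixed_free f y z -> fixed_free f x z.
Proof.
move=> Hxy Hyz t xtz; have [ty|ty] := leP t y.
  have [xt|xt] := leP x t; first by apply: Hxy; rewrite xt ty.
  apply: Hyz; move: xtz; rewrite leNgt xt/= => /andP[-> _].
  by rewrite ty orbT.
have [xt|xt] := leP t x; first by apply: Hxy; rewrite xt (ltW ty) orbT.
apply: Hyz; move: xtz; rewrite [t <= x]leNgt xt/= andbF orbF => /andP[_ ->].
by rewrite (ltW ty).
Qed.

(* [A] is the inverse of a solution of Abel's equation on the component of [w]
   in the complement of the fixed points: it interpolates the orbit of [w]. *)
Lemma abel_param_pos f w : incbij f -> w < f w ->
  exists A : R -> R, [/\ {homo A : x y / x < y},
    forall s, A (s + 1) = f (A s), forall s, fixed_free f w (A s) &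
    forall x, fixed_free f w x -> exists s, A s = x].
Proof.
move=> bf wf; have [g [bg fK gK]] := incbij_inv bf.
pose O n := iterz f g n; have OS n x : O (n + 1) x = f (O n x) by exact: iterzS.
have bO n : incbij (O n) by exact: incbij_iterz.
have OSf n x : O (n + 1) x = O n (f x).
  rewrite OS; case: n => n; first by rewrite /= -iterSr.
  have {1}-> : x = g (f x) by rewrite fK.
  by rewrite /O /iterz -iterSr iterS gK.
pose d := f w - w; have d0 : 0 < d by rewrite subr_gt0.
(* [A] runs affinely over the fundamental domain between [w] and [f w] and is transported by the
   powers of [f]. *)
pose A s := O (Num.floor s) (w + (s - (Num.floor s)%:~R) * d).
have AE (i : int) s : i%:~R <= s <= (i + 1)%:~R ->
    A s = O i (w + (s - i%:~R) * d).
  move=> /andP[is_]; rewrite le_eqVlt => /orP[/eqP->|si].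
    rewrite /A intrKfloor subrr mul0r addr0 OSf; congr (O i _).
    by rewrite intrD addrAC subrr add0r mul1r /d addrC subrK.
  by rewrite /A (floor_def (m := i)) ?is_.
have Am : {homo A : x y / x < y}.
  apply: glue_homo => i x y ix xy yi.
  rewrite (AE i x) ?ix ?(le_trans (ltW xy) yi)//.
  rewrite (AE i y) ?yi ?(le_trans ix (ltW xy))//.
  by rewrite (incbij_lt (bO i)) ltrD2l ltr_pM2r// ltrD2r.
have AS s : A (s + 1) = f (A s).
  have /andP[ls rs] := floor_itv s.
  rewrite (AE (Num.floor s + 1)) ?(AE (Num.floor s)) ?ls ?(ltW rs)//.
    by rewrite OS !intrD; congr (f (O _ (_ + _ * d))); ring.
  by rewrite !intrD !lerD2r ls/=; move: (ltW rs); rewrite intrD.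
have Ai (i : int) : A i%:~R = O i w.
  by rewrite /A intrKfloor subrr mul0r addr0.
have Alt s : A s < f (A s) by rewrite -AS; apply: Am; rewrite ltrDl.
have gA s : g (A s) = A (s - 1) by rewrite -{1}[s](subrK 1) AS fK.
have A0 : A 0 = w by rewrite -[0]/(0%:~R) Ai.
have Aff s : fixed_free f w (A s).
  (* A fixed point below [A t] is below [A (t - 1)], hence below the whole curve; it cannot lie
     between two of its points. *)
  move=> z wz fz.
  have zltA t : z <= A t -> z <= A (t - 1).
    by move=> zt; rewrite -gA -(incbij_le bf) gK fz.
  have zltAn t n : z <= A t -> z <= A (t - n%:R).
    elim: n t => [|n IH] t zt; first by rewrite subr0.
    by rewrite -addn1 natrD opprD addrA; apply/zltA/IH.
  have Ale : {mono A : x y / x <= y} by exact: le_mono.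
  have key a b : A a <= z -> z <= A b -> False.
    move=> az zb; have [n nab] : exists n : nat, b - a < n%:R.
      exists (Num.Def.archi_bound `|b - a|).
      exact: le_lt_trans (ler_norm _) (archi_boundP _).
    have := zltAn b n zb; rewrite leNgt => /negP; apply.
    by apply: lt_le_trans az; rewrite (leW_mono Ale); lra.
  by case/orP: wz => /andP[wz zs]; [apply: (key 0 s)|apply: (key s 0)];
    rewrite ?A0.
exists A; split=> // x wx.
have [i ix] : exists i : int, O i w <= x.
  have [xw|xw] := leP w x; first by exists 0.
  (* Points below [w] are reached by the backward orbit, which reflection turns into an upward
     one. *)
  pose f' x := - g (- x).
  have fg' n : iter n f' (- w) = - iter n g w.
    by elim: n => [//|n /= ->]; rewrite /f' opprK.
  have [|||n] := @iter_escape f' (- w) (- x) (incbij_opp bg).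
  - by rewrite /f' opprK ltrN2 -(incbij_lt bf) gK.
  - by rewrite lerN2 ltW.
  - move=> z /andP[wz zx] /(congr1 (f \o -%R)) /=.
    rewrite /f' opprK gK => zE; apply: (wx (- z)); last exact: esym zE.
    by apply/orP; right; rewrite lerNr zx lerNl wz.
  rewrite fg' ltrN2 => nx; exists (- n%:Z); case: n nx => [|n] nx.
    exact: ltW.
  exact: ltW.
have [j xj] : exists j : nat, x < O (i + j%:Z) w.
  have [n xn] : exists n : nat, x < O n w.
    have [wx'|xw'] := leP w x; last by exists 0%N.
    apply: (iter_escape bf wf wx') => z zwx; apply: wx; rewrite zwx.
    by [].
  have Omono : {mono (fun k => O k w) : k l / k < l}.
    apply: int_mono => k; rewrite -!Ai; apply: Am.
    by rewrite ltr_int ltrDl.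
  exists (absz (n%:Z - i)%R); apply: (lt_le_trans xn).
  rewrite leNgt; apply/negP; rewrite Omono; lia.
have [k /andP[k1 k2]] := int_cross (a := fun k => O k w) ix xj.
have [y yE] := (bO k).2 x.
have wy : w <= y by rewrite -(incbij_le (bO k)) yE.
have yw : y < f w by rewrite -(incbij_lt (bO k)) yE -OSf.
exists (k%:~R + (y - w) / d); rewrite (AE k).
  by rewrite addrAC subrr add0r divfK ?gt_eqF// addrC subrK.
rewrite lerDl divr_ge0 ?subr_ge0 ?(ltW wf)//=.
by rewrite intrD lerD2l ler_pdivrMr// mul1r /d lerD2r ltW.
Qed.

Lemma fixed_free_inv f g x y : cancel f g -> cancel g f ->
  fixed_free g x y <-> fixed_free f x y.
Proof.
move=> fK gK; split=> H z /H + e; first by rewrite -{1}e fK.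
by rewrite -{1}e gK.
Qed.

(** If [f] moves [w] down, its inverse moves [w] up and has the same fixed points; its
    parametrization serves, with the shift reversed. *)
Lemma abel_param f w : incbij f -> f w <> w ->
  exists A : R -> R, [/\ {homo A : x y / x < y},
    forall s, f (A s) = A (s + (-1) ^+ (f w < w)%R),
    forall s, fixed_free f w (A s) &
    forall x, fixed_free f w x -> exists s, A s = x].
Proof.
move=> bf; case: (ltgtP (f w) w) => // [fw|wf] _; last first.
  have [A [Am AS Af As]] := abel_param_pos bf wf.
  by exists A; split=> // s; rewrite expr0 AS.
have [g [bg fK gK]] := incbij_inv bf.
have wg : w < g w by rewrite -(incbij_lt bf) gK.
have [A [Am AS Af As]] := abel_param_pos bg wg.
exists A; split=> // [s|s|x].
- by rewrite expr1 -{1}[s](subrK 1) AS gK.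
- exact/(fixed_free_inv _ _ fK gK).
- by move=> /(fixed_free_inv _ _ fK gK)/As.
Qed.

Definition same_sign f g :=
  forall x, (f x < x) = (g x < x) /\ (x < f x) = (x < g x).

Lemma same_sign_fix f g x : same_sign f g -> f x = x <-> g x = x.
Proof.
move=> /(_ x)[lE gE].
have E h : (h x == x) = ~~ (h x < x) && ~~ (x < h x) by case: ltgtP.
have e : (f x == x) = (g x == x) by rewrite !E lE gE.
by split=> /eqP; [rewrite e|rewrite -e] => /eqP.
Qed.

(** On a component, Abel coordinates turn both maps into the same shift by 1 or -1, and identifying
    the coordinates conjugates them; the fixed points stay in place. All points of a component must
    use one base point, whence [rep]. *)
Lemma conjugate_same_sign f g :
  incbij f -> incbij g -> same_sign f g -> conjugate f g.
Proof.
move=> bf bg fg; have fixE x := same_sign_fix x fg.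
(* Points of one component define the same set, so [xget] returns the same representative; the
   default 0 occurs only at fixed points. *)
pose rep x : R := xget 0 [set y | fixed_free f x y].
have repP x : f x <> x -> fixed_free f x (rep x).
  by move=> fx; apply: (xgetPex 0 (P := [set y | fixed_free f x y]));
    exists x; exact: fixed_freexx.
have repE x y : fixed_free f x y -> rep x = rep y.
  move=> xy; congr xget; apply/seteqP; split=> z /= xz.
    by apply: fixed_free_trans xz; exact: fixed_free_sym.
  exact: fixed_free_trans xz.
have rep_nfix x : f x <> x -> f (rep x) <> rep x.
  by move=> /repP/fixed_freeWr.
have ffE x y : fixed_free f x y <-> fixed_free g x y.
  by split=> H z /H + /fixE.
have /choice[AB HAB] : forall w, exists AB : (R -> R) * (R -> R), f w <> w ->
    [/\ {homo AB.1 : x y / x < y}, {homo AB.2 : x y / x < y},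
    exists e, forall s, f (AB.1 s) = AB.1 (s + e) /\
                        g (AB.2 s) = AB.2 (s + e),
    forall s, fixed_free f w (AB.1 s) /\ fixed_free f w (AB.2 s) &
    forall x, fixed_free f w x ->
      (exists s, AB.1 s = x) /\ (exists s, AB.2 s = x)].
  move=> w; have [fw|fw] := pselect (f w = w).
    by exists (id, id).
  have gw : g w <> w by move=> /fixE.
  have [A [Am AS Af As]] := abel_param bf fw.
  have [B [Bm BS Bf Bs]] := abel_param bg gw.
  exists (A, B) => _; split=> //=.
  - by exists ((-1) ^+ (f w < w)%R) => s; rewrite AS BS (fg w).1.
  - by move=> s; split=> //; apply/ffE.
  - by move=> x wx; split; [exact: As|apply/Bs/ffE].
have /choice[S HS] : forall x, exists s, f x <> x -> (AB (rep x)).1 s = x.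
  move=> x; have [fx|fx] := pselect (f x = x); first by exists 0.
  have [_ _ _ _ /(_ x)[|[s sE] _]] := HAB _ (rep_nfix _ fx).
    by apply: fixed_free_sym; exact: repP.
  by exists s.
pose c x := if f x == x then x else (AB (rep x)).2 (S x).
have cfix x : f x = x -> c x = x by rewrite /c => ->; rewrite eqxx.
have cnfix x : f x <> x -> c x = (AB (rep x)).2 (S x).
  by rewrite /c => /eqP/negbTE ->.
have cff x : f x <> x -> fixed_free f x (c x).
  move=> fx; rewrite cnfix//; have [_ _ _ /(_ (S x))[_ H] _] := HAB _ (rep_nfix _ fx).
  exact: fixed_free_trans (repP _ fx) H.
have cnf x : f x <> x -> f (c x) <> c x.
  by move=> /cff/fixed_freeWr.
(* The map [c] stays in the component of its argument, so it cannot jump over a fixed point; this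
   gives monotonicity across components. *)
have side z x : f z = z -> (x < z -> c x < z) /\ (z < x -> z < c x).
  move=> fz; have [fx|fx] := pselect (f x = x); first by rewrite cfix.
  by split=> xz; rewrite ltNge; apply/negP => zx; apply: (cff _ fx z) fz;
    rewrite ?(ltW xz) ?zx ?orbT.
exists c; split; first split.
- move=> x y xy.
  have [xyff|] := pselect (fixed_free f x y).
    have fx : f x <> x by apply: xyff; rewrite lexx (ltW xy).
    have fy : f y <> y by apply: xyff; rewrite lexx (ltW xy).
    have [Am Bm _ _ _] := HAB _ (rep_nfix _ fx).
    rewrite !cnfix// -(repE _ _ xyff); apply: Bm.
    by rewrite -(leW_mono (le_mono Am)) HS// (repE _ _ xyff) HS.
  move=> /existsNP[z /not_implyP[+ /contrapT fz]].
  have -> : (y <= z <= x) = false.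
    by apply/negbTE/negP => /andP[yz zx]; have := le_trans yz zx; rewrite leNgt xy.
  rewrite orbF => /andP[].
  rewrite le_eqVlt => /orP[/eqP xz|xz].
    rewrite -xz in fz.
    by move=> _; rewrite (cfix x)//; apply: (side x y fz).2.
  rewrite le_eqVlt => /orP[/eqP zy|zy].
    by rewrite -zy (cfix z)//; apply: (side z x fz).1.
  exact: lt_trans ((side z x fz).1 xz) ((side z y fz).2 zy).
- move=> y; have [fy|fy] := pselect (f y = y); first by exists y; rewrite cfix.
  have [Am Bm _ Hff Hs] := HAB _ (rep_nfix _ fy).
  have [_ [s sE]] := Hs y (fixed_free_sym (repP _ fy)).
  pose x := (AB (rep y)).1 s.
  have yx : fixed_free f y x.
    exact: fixed_free_trans (repP _ fy) (Hff s).1.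
  have fx : f x <> x := fixed_freeWr yx.
  exists x; rewrite cnfix// -(repE _ _ yx) -[RHS]sE; congr (_ _).
  apply: (inc_inj (le_mono Am)); rewrite -[RHS]/x.
  by rewrite [in LHS](repE _ _ yx) HS.
- move=> x; have [fx|fx] := pselect (f x = x).
    by rewrite fx cfix//; apply/esym/fixE.
  have [Am Bm [e He] Hff Hs] := HAB _ (rep_nfix _ fx).
  have fxE : f x = (AB (rep x)).1 (S x + e) by rewrite -(He _).1 HS.
  have xfx : fixed_free f x (f x).
    by rewrite fxE; exact: fixed_free_trans (repP _ fx) (Hff _).1.
  have ffx : f (f x) <> f x by move/(incbij_inj bf).
  rewrite !cnfix// -(repE _ _ xfx) (He _).2; congr (_ _).
  apply: (inc_inj (le_mono Am)); rewrite -fxE.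
  by rewrite [in LHS](repE _ _ xfx) HS.
Qed.

End conjugacy.

(** * Sign sequences as conjugacy invariants *)

Section types.
Variable R : realType.
Implicit Types (f g : R -> R) (s : int -> bool).

(* [s i] is the sign of [f - id] between the consecutive nodes [z i] and
   [z (i + 1)]; the nodes at which the sign changes are the fixed points. *)
Definition has_type s f := exists2 z : int -> R, bi_unbounded z &
  forall i, (forall x, z i < x < z (i + 1) -> f x != x /\ (x < f x) = s i) /\
    (if s (i - 1) == s i then f (z i) != z i /\ (z i < f (z i)) = s i
     else f (z i) = z i).

(** Interpolation moves the nodes of either map to the integers; after that the two maps have equal
    signs everywhere. *)
Lemma has_type_conjugate s f g : incbij f -> incbij g ->
  has_type s f -> has_type s g -> conjugate f g.
Proof.
have norm h : incbij h -> has_type s h -> exists h', [/\ incbij h',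
    conjugate h h' & forall i : int,
    (forall x, i%:~R < x < (i + 1)%:~R -> h' x != x /\ (x < h' x) = s i) /\
    (if s (i - 1) == s i then h' i%:~R != i%:~R /\ (i%:~R < h' i%:~R) = s i
     else h' i%:~R = i%:~R)].
  move=> bh [z zu Hz]; have [p [bp pE]] := interpolate zu.
  have [q [bq pK qK]] := incbij_inv bp.
  exists (q \o h \o p); split.
  - by apply: incbij_comp bp; exact: incbij_comp bh.
  - by exists q; split=> // x /=; rewrite qK.
  - have E x : ((q (h (p x)) == x) = (h (p x) == p x)) /\
        ((x < q (h (p x))) = (p x < h (p x))).
      rewrite -(inj_eq (incbij_inj bp)) qK; split=> //.
      by rewrite -(incbij_lt bp) qK.
    move=> i; have [Hi1 Hi2] := Hz i; split=> [x /andP[ix xi]|/=].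
      rewrite /= !(E x).1 !(E x).2; apply: Hi1.
      by rewrite -!pE !(incbij_lt bp) ix.
    move: Hi2; rewrite -pE; case: ifP => _; first by rewrite (E _).1 (E _).2.
    by move=> h'; apply/eqP; rewrite (E _).1; apply/eqP.
move=> bf bg /(norm _ bf)[f' [bf' cf Hf]] /(norm _ bg)[g' [bg' cg Hg]].
apply: (conjugate_trans cf); apply: conjugate_trans (conjugate_sym cg).
apply: conjugate_same_sign => // x.
suff [eqE ltE] : (f' x == x) = (g' x == x) /\ (x < f' x) = (x < g' x).
  by split=> //; rewrite !lt_neqAle eqE !leNgt ltE.
have /andP[] := floor_itv x; set i := Num.floor x.
rewrite le_eqVlt => /orP[/eqP <- _|ix xi].
  have := (Hf i).2; have := (Hg i).2; case: ifP => _; last by move=> -> ->.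
  by move=> [/negbTE -> ->] [/negbTE -> ->].
have [/negbTE -> ->] : f' x != x /\ (x < f' x) = s i by apply: (Hf i).1; rewrite ix.
by have [/negbTE -> ->] : g' x != x /\ (x < g' x) = s i by apply: (Hg i).1; rewrite ix.
Qed.

Lemma incbij_sign_const f a b : incbij f -> a <= b ->
  (forall x, a <= x <= b -> f x <> x) -> (a < f a) = (b < f b).
Proof.
move=> bf ab nofix.
have cont : {within `[a, b], continuous (fun x => f x - x)}.
  apply: continuous_subspaceT => x.
  by apply: cvgB; [exact: incbij_continuous|exact: cvg_id].
have fa : f a != a by apply/eqP/nofix; rewrite lexx.
have fb : f b != b by apply/eqP/nofix; rewrite lexx andbT.
have key : Num.min (f a - a) (f b - b) <= 0 <= Num.max (f a - a) (f b - b) -> False.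
  move=> /(IVT ab cont)[c]; rewrite in_itv/= => cab /eqP.
  by rewrite subr_eq0 => /eqP; exact: nofix.
case: (ltgtP a (f a)) fa => // fa _; case: (ltgtP b (f b)) fb => // fb _;
  exfalso; apply: key; rewrite ge_min le_max; apply/andP; split; apply/orP; by lra.
Qed.

(** Each interval between consecutive samples receives one node: the fixed point if the sign
    changes, the midpoint otherwise. *)
Lemma has_type_of_samples s f (t : int -> R) : incbij f -> bi_unbounded t ->
  (forall i, [/\ f (t i) != t i, (t i < f (t i)) = s i,
    forall x y, t i <= x <= t (i + 1) -> t i <= y <= t (i + 1) ->
      f x = x -> f y = y -> x = y &
    s i = s (i + 1) -> forall x, t i <= x <= t (i + 1) -> f x <> x]) ->
  has_type s f.
Proof.
move=> bf [tS tl tr] Ht.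
have /choice[z Hz] : forall i, exists z, t i < z < t (i + 1) /\
    (s i <> s (i + 1) -> f z = z).
  move=> i; have [e|ne] := pselect (s i = s (i + 1)).
    by exists ((t i + t (i + 1)) / 2); split=> //; have := tS i; lra.
  apply: contrapT => H; apply: ne; have [nfi si _ _] := Ht i.
  have [nfi1 si1 _ _] := Ht (i + 1); rewrite -si -si1.
  apply: incbij_sign_const => //; first exact: ltW.
  move=> x /andP[]; rewrite le_eqVlt => /orP[/eqP <- _|tx]; first exact/eqP.
  rewrite le_eqVlt => /orP[/eqP ->|xt]; first exact/eqP.
  by move=> fx; apply: H; exists x; rewrite tx xt.
have nofix i x : t i <= x <= t (i + 1) -> x <> z i -> f x <> x.
  move=> xi xz fx; have [_ _ uniq none] := Ht i.
  have [e|ne] := pselect (s i = s (i + 1)); first exact: (none e x).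
  have [/andP[z1 z2] fz] := Hz i; apply: xz; apply: uniq => //.
  - by rewrite (ltW z1) (ltW z2).
  - exact: fz.
(* Sample [i] has to lie between nodes [i] and [i + 1], while [z i] lies to its right; hence the
   shift. *)
exists (fun i => z (i - 1)); first split.
- move=> i; have [/andP[_ z2] _] := Hz (i - 1); rewrite addrK.
  by have [/andP[z1 _] _] := Hz i; rewrite subrK in z2; exact: lt_trans z1.
- move=> y; have [i iy] := tl y; exists i.
  have [/andP[_ z2] _] := Hz (i - 1); rewrite subrK in z2.
  exact: le_trans (ltW z2) iy.
- move=> y; have [i yi] := tr y; exists (i + 1); rewrite addrK.
  by have [/andP[z1 _] _] := Hz i; exact: le_trans yi (ltW z1).
move=> i; have [nfi si _ _] := Ht i.
have [/andP[a1 a2] za] := Hz (i - 1); have [/andP[b1 b2] _] := Hz i.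
rewrite subrK in a2 za; split.
  rewrite addrK => x /andP[zx xz].
  have nfx y : x <= y <= t i -> f y <> y.
    move=> /andP[xy yt]; apply: (@nofix (i - 1)).
      by rewrite subrK yt (ltW (lt_le_trans (lt_trans a1 zx) xy)).
    by move=> yE; move: (lt_le_trans zx xy); rewrite yE ltxx.
  have nfx' y : t i <= y <= x -> f y <> y.
    move=> /andP[ty yx]; apply: (@nofix i).
      by rewrite ty (ltW (le_lt_trans yx (lt_trans xz b2))).
    by move=> yE; move: (le_lt_trans yx xz); rewrite yE ltxx.
  have [xt|tx] := leP x (t i).
    split; first by apply/eqP/nfx; rewrite lexx xt.
    by rewrite (incbij_sign_const bf xt nfx).
  split; first by apply/eqP/nfx'; rewrite lexx (ltW tx).
  by rewrite -si (incbij_sign_const bf (ltW tx) nfx').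
case: eqP => [e|/za //].
have [_ _ _ /(_ _) none] := Ht (i - 1); rewrite subrK in none.
have {}none := none e.
split; first by apply/eqP/none; rewrite (ltW a1) (ltW a2).
rewrite (incbij_sign_const bf (ltW a2))// => y /andP[zy yt].
by apply: none; rewrite yt (le_trans (ltW a1) zy).
Qed.

(** The next point is chosen greedily: it covers more than half of the supremum of the steps allowed
    by [P] and the cap 1. The sequence cannot converge, since near a limit [P] allows steps of a
    fixed length. *)
Lemma subdivide (P : R -> R -> Prop) (D : R -> Prop) t0 :
  (forall a b a' b', a <= a' -> b' <= b -> P a b -> P a' b') ->
  (forall z, exists2 e, 0 < e & P (z - e) (z + e)) ->
  (forall a b, a < b -> exists x, a < x < b /\ D x) -> D t0 ->
  exists t : nat -> R, [/\ t 0%N = t0,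
    forall n, [/\ t n < t n.+1, D (t n) & P (t n) (t n.+1)] &
    forall y, exists n, y < t n].
Proof.
move=> Pm Ploc Dd Dt0.
have /choice[next Hnext] : forall a, exists b, [/\ a < b, D b, P a b &
    forall x, x <= a + 1 -> P a x -> x - a <= 2 * (b - a)].
  move=> a; pose A := [set x | x <= a + 1 /\ P a x]; pose u := sup A.
  have [e e0 Pe] := Ploc a; pose x0 := a + Num.min e 1.
  have ax0 : a < x0 by rewrite ltrDl lt_min e0 ltr01.
  have Ax0 : A x0.
    split; first by rewrite lerD2l ge_min lexx orbT.
    by apply: Pm Pe; rewrite ?lerBlDr ?lerDl ?(ltW e0)// lerD2l ge_min lexx.
  have hA : has_sup A by split; [exists x0|exists (a + 1) => x []].
  have au : a < u by apply: (lt_le_trans ax0); exact: (ub_le_sup hA.2).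
  have auu : (a + u) / 2 < u by lra.
  have [b [/andP[b1 b2] Db]] := Dd _ _ auu.
  have u0 : 0 < u - b by rewrite subr_gt0.
  have [x [_ Px]] := sup_adherent u0 hA; rewrite subKr => bx.
  exists b; split=> //; [lra|by apply: Pm Px => //; exact: ltW|].
  move=> y ya Py; have : y <= u by apply: (ub_le_sup hA.2).
  by lra.
pose t n := iter n next t0.
have tS n : t n < t n.+1 by have [] := Hnext (t n).
exists t; split=> // [n|y].
  split=> //; first by case: n => // n; have [] := Hnext (t n).
  by have [] := Hnext (t n).
apply: contrapT => /forallNP Hn.
pose u := sup (range t).
have ht : has_sup (range t).
  split; first by exists t0, 0%N.
  by exists y => _ [n _ <-]; rewrite leNgt; apply/negP/Hn.
have tu n : t n <= u by apply: (ub_le_sup ht.2); exists n.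
(* With [d] at most 1/4 the point [u + d / 2] respects the cap. From a term within [d / 8] of [u]
   the next step is shorter than [d / 8], although one of length at least [d / 2] is allowed. *)
have [e e0 Pe] := Ploc u; pose d := Num.min e 4^-1.
have d0 : 0 < d by rewrite lt_min e0 invr_gt0 ltr0n.
have de : d <= e by rewrite ge_min lexx.
have d4 : d <= 4^-1 by rewrite ge_min lexx orbT.
have d8 : 0 < d / 8 by rewrite divr_gt0.
have [_ [n _ <-]] := sup_adherent d8 ht; rewrite -/u => un.
have [_ _ _ /(_ (u + d / 2))] := Hnext (t n).
have tn := tu n; have tn1 : next (t n) <= u := tu n.+1.
have -> : u + d / 2 <= t n + 1 by lra.
move=> /(_ isT) H.
have : P (t n) (u + d / 2) by apply: Pm Pe; lra.
by move=> /H; lra.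
Qed.

Definition has_limit_fix f := exists z, forall e, 0 < e ->
  exists x, [/\ x != z, `|x - z| < e & f x = x].

Definition touches f := exists z, f z = z /\ exists2 e, 0 < e &
  (forall x, `|x - z| < e -> x <= f x) \/ (forall x, `|x - z| < e -> f x <= x).

(** Without limit points the line can be cut at non-fixed points into intervals with at most one
    fixed point each. If the ends of an interval have the same sign, a fixed point inside would be a
    touching point. *)
Lemma crossing_has_type f : incbij f -> ~ has_limit_fix f -> ~ touches f ->
  exists s, has_type s f.
Proof.
move=> bf nl nt.
pose P a b := forall x y, a <= x <= b -> a <= y <= b -> f x = x -> f y = y -> x = y.
pose D x := f x != x.
have Pm a b a' b' : a <= a' -> b' <= b -> P a b -> P a' b'.
  move=> aa bb H x y /andP[x1 x2] /andP[y1 y2]; apply: H.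
    by rewrite (le_trans aa x1) (le_trans x2 bb).
  by rewrite (le_trans aa y1) (le_trans y2 bb).
have loc z : exists2 e, 0 < e & forall x, `|x - z| < e -> f x = x -> x = z.
  apply: contrapT => /forall2NP H; apply: nl; exists z => e e0.
  have [//|/existsNP[x /not_implyP[xz /not_implyP[fx xnz]]]] := H e.
  by exists x; split=> //; exact/eqP.
have Ploc z : exists2 e, 0 < e & P (z - e) (z + e).
  have [e e0 He] := loc z; exists (e / 2); first by rewrite divr_gt0.
  have lt_e x : z - e / 2 <= x <= z + e / 2 -> `|x - z| < e.
    by move=> /andP[x1 x2]; rewrite ltr_distl; apply/andP; split; lra.
  by move=> x y /lt_e xz /lt_e yz fx fy; rewrite (He x)// (He y).
have Dd a b : a < b -> exists x, a < x < b /\ D x.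
  move=> ab; apply: contrapT => H.
  have fixD x : a < x < b -> f x = x.
    by move=> xab; apply/eqP/negPn/negP => Dx; apply: H; exists x.
  have [e e0 Pe] := Ploc ((a + b) / 2).
  pose d := Num.min e ((b - a) / 4).
  have d0 : 0 < d by rewrite lt_min e0 divr_gt0 ?subr_gt0.
  have de : d <= e by rewrite ge_min lexx.
  have dab : d <= (b - a) / 4 by rewrite ge_min lexx orbT.
  have : (a + b) / 2 = (a + b) / 2 + d.
    by apply: Pe; rewrite ?fixD//; apply/andP; split; lra.
  lra.
have [t0 [_ Dt0]] := Dd 0 1 ltr01.
have [tp [tp0 Htp Hpu]] := subdivide Pm Ploc Dd Dt0.
(* The negative half comes from the reflected problem. *)
have [||||tm [tm0 Htm Hmu]] := @subdivide (fun a b => P (- b) (- a)) (fun x => D (- x)) (- t0).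
- by move=> a b a' b' aa bb; apply: Pm; rewrite lerN2.
- move=> z; have [e e0 Pe] := Ploc (- z); exists e => //.
  by apply: Pm Pe; lra.
- move=> a b; rewrite -ltrN2 => /Dd[x [/andP[x1 x2] Dx]]; exists (- x).
  by rewrite opprK ltrNr x2 ltrNl x1.
- by rewrite opprK.
pose t (i : int) := match i with Posz n => tp n | Negz n => - tm n.+1 end.
have tNn (n : nat) : t (- n%:Z) = - tm n by case: n => [|n]; rewrite ?oppr0 /t ?tp0 ?tm0 ?opprK.
have Ht i : [/\ t i < t (i + 1), D (t i) & P (t i) (t (i + 1))].
  case: i => [n|n]; first by rewrite -PoszD addn1; exact: Htp.
  have -> : Negz n + 1 = - n%:Z by lia.
  rewrite tNn /t; have [tl _ Pn] := Htm n; have [_ Dn _] := Htm n.+1.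
  by split=> //; rewrite ltrN2.
exists (fun i => t i < f (t i)); apply: (has_type_of_samples (t := t)) => //.
  split=> [i|y|y]; first by have [] := Ht i.
    by have [n yn] := Hmu (- y); exists (- n%:Z); rewrite tNn lerNl ltW.
  by have [n yn] := Hpu y; exists n%:Z; exact: ltW.
move=> i; have [ti Di Pi] := Ht i; split=> // si x /andP[].
have [_ Di1 _] := Ht (i + 1).
rewrite le_eqVlt => /orP[/eqP <- _|tx]; first exact/eqP.
rewrite le_eqVlt => /orP[/eqP ->|xt]; first exact/eqP.
move=> fx; apply: nt; exists x; split=> //.
have sgn y : t i <= y <= t (i + 1) -> y != x -> (y < f y) = (t i < f (t i)) /\ f y != y.
  move=> /andP[y1 y2] yx.
  have nofix z : t i <= z <= t (i + 1) -> z != x -> f z <> z.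
    by move=> zi /eqP zx fz; apply: zx; apply: Pi => //; rewrite (ltW tx) (ltW xt).
  split; last by apply/eqP/nofix; rewrite ?y1.
  have [ltyx|ltxy|yxE] := ltgtP y x; last by rewrite yxE eqxx in yx.
    apply/esym/incbij_sign_const => // z /andP[z1 z2].
    apply: nofix; first by rewrite z1 (le_trans z2 y2).
    by rewrite lt_eqF// (le_lt_trans z2).
  rewrite si; apply: incbij_sign_const => // z /andP[z1 z2].
  apply: nofix; first by rewrite z2 (le_trans y1 z1).
  by rewrite gt_eqF// (lt_le_trans ltxy).
exists (Num.min (x - t i) (t (i + 1) - x)); first by rewrite lt_min !subr_gt0 tx.
have bnd y : `|y - x| < Num.min (x - t i) (t (i + 1) - x) -> t i <= y <= t (i + 1).
  by rewrite lt_min !ltr_distl => /andP[/andP[? ?] /andP[? ?]]; lra.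
case: (boolP (t i < f (t i))) => up; [left|right] => y /bnd yi;
  have [->|/(sgn y yi)[]] := eqVneq y x; rewrite ?fx// => E ny.
  by rewrite ltW// E.
by rewrite leNgt E.
Qed.

End types.

(** * Level sets of differences of monotone functions *)

Lemma le_limn_einf (R : realType) (u : (\bar R)^nat) (a : \bar R) N :
  (forall n, (N <= n)%N -> (a <= u n)%E) -> (a <= limn_einf u)%E.
Proof.
move=> H; rewrite limn_einf_lim (cvg_lim _ (@cvg_einfs_sup R u))//.
apply: (@le_trans _ _ (einfs u N)); last by apply: ereal_sup_ubound; exists N.
by apply: le_ereal_inf_tmp => _ [n /= Nn <-]; exact: H.
Qed.

Lemma limn_einf_le (R : realType) (u : (\bar R)^nat) (a : \bar R) :
  (forall n, (u n <= a)%E) -> (limn_einf u <= a)%E.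
Proof.
move=> H; rewrite limn_einf_lim (cvg_lim _ (@cvg_einfs_sup R u))//.
apply: ge_ereal_sup => _ [n _ <-]; apply: le_trans (H n).
by apply: ereal_inf_lbound; exists n => /=.
Qed.

Section level_sets.
Variable R : realType.
Implicit Types (u v : R -> R) (p q c x y : R).

Definition cell p q n i : R := p + (q - p) * (i%:R / n.+1%:R).

(* The number of cells of [p, q] in which monotonicity of [u] and [v] does not
   rule out a solution of [u x - v x = c]. *)
Definition hits u v p q c n : nat := (\sum_(i < n.+1)
  ((u (cell p q n i) - v (cell p q n i.+1) <= c) &&
   (c <= u (cell p q n i.+1) - v (cell p q n i)))%R)%N.

Lemma cell0 p q n : cell p q n 0 = p.
Proof. by rewrite /cell mul0r mulr0 addr0. Qed.

Lemma cell_max p q n : cell p q n n.+1 = q.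
Proof. by rewrite /cell divff ?mulr1 ?subrKC// pnatr_eq0. Qed.

Lemma cell_homo p q n : p <= q -> {homo cell p q n : i j / (i <= j)%N >-> i <= j}.
Proof.
move=> pq i j ij; rewrite lerD2l ler_wpM2l ?subr_ge0//.
by rewrite ler_wpM2r ?invr_ge0 ?ler_nat ?ler0n.
Qed.

Lemma cell_index p q n x : p <= x < q ->
  exists i : 'I_n.+1, cell p q n i <= x < cell p q n i.+1.
Proof.
move=> /andP[px xq].
suff: forall m, x < cell p q n m -> (m <= n.+1)%N ->
    exists i : 'I_n.+1, cell p q n i <= x < cell p q n i.+1.
  by apply; last exact: leqnn; rewrite cell_max.
elim=> [|m IH]; first by rewrite cell0 ltNge px.
move=> xm mn; have [xm'|xm'] := ltP x (cell p q n m).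
  by apply: IH => //; exact: ltnW.
by exists (Ordinal mn); rewrite /= xm' xm.
Qed.

(** Once the mesh is below all distances between the solutions, each occupies a cell of its own. *)
Lemma hits_ge u v p q c (s : seq R) : {homo u : x y / x <= y} ->
  {homo v : x y / x <= y} -> uniq s ->
  (forall x, x \in s -> p <= x < q /\ u x - v x = c) ->
  exists N, forall n, (N <= n)%N -> (size s <= hits u v p q c n)%N.
Proof.
move=> um vm su Hs.
have [->|s0] := eqVneq s [::]; first by exists 0%N.
have pq : p < q.
  case: s s0 {su} Hs => // x s _ /(_ x (mem_head _ _))[/andP[? ?] _].
  by apply: le_lt_trans; eassumption.
have cellS n i : cell p q n i.+1 = cell p q n i + (q - p) / n.+1%:R.
  by rewrite /cell -[i.+1%:R]natr1; ring.
pose N x y := Num.Def.archi_bound ((q - p) / `|x - y|).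
have HN x y n : (N x y <= n)%N -> x != y -> (q - p) / n.+1%:R < `|x - y|.
  move=> nN xy; have d0 : 0 < `|x - y| by rewrite normr_gt0 subr_eq0.
  rewrite ltr_pdivrMr ?ltr0n// mulrC -ltr_pdivrMr//.
  apply: lt_le_trans (archi_boundP _) _.
    by rewrite divr_ge0 ?subr_ge0 ?(ltW pq).
  by rewrite ler_nat (leq_trans nN).
exists (\max_(x <- s) \max_(y <- s) N x y)%N => n nN.
have nN' x y : x \in s -> y \in s -> (N x y <= n)%N.
  move=> xs ys; apply: leq_trans nN.
  apply: leq_trans (leq_bigmax_seq x xs isT).
  exact: (leq_bigmax_seq y ys isT).
have /choice[idx Hidx] : forall x, exists i : 'I_n.+1,
    p <= x < q -> cell p q n i <= x < cell p q n i.+1.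
  move=> x; have [xpq|xpq] := pselect (p <= x < q).
    by have [i Hi] := cell_index n xpq; exists i.
  by exists ord0 => /xpq.
have idx_inj : {in s &, injective idx}.
  move=> x y xs ys e; apply/eqP/negPn/negP => xy.
  have /andP[x1 x2] := Hidx x (Hs x xs).1.
  have /andP[y1 y2] := Hidx y (Hs y ys).1.
  have := HN x y n (nN' _ _ xs ys) xy; apply/negP; rewrite -leNgt.
  rewrite e in x1 x2; rewrite cellS in x2 y2.
  move: x2 y2; set D := (q - p) / _ => x2 y2.
  by rewrite ler_norml; apply/andP; split; lra.
have hE : hits u v p q c n = #|[pred i : 'I_n.+1 |
  (u (cell p q n i) - v (cell p q n i.+1) <= c) &&
  (c <= u (cell p q n i.+1) - v (cell p q n i))]|.
  rewrite -sum1_card [RHS]big_mkcond /hits.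
  by apply: eq_bigr => i _; rewrite inE; case: (_ && _).
rewrite hE -(size_map idx s) -(card_uniqP _); last by rewrite map_inj_in_uniq.
apply: subset_leq_card; apply/fintype.subsetP => _ /mapP[x xs ->].
rewrite inE; have [xpq <-] := Hs x xs; have /andP[x1 x2] := Hidx x xpq.
by rewrite !lerB ?um ?vm// ltW.
Qed.

(** A discrete intermediate value argument: some cell has difference at most [c] at its left end and
    at least [c] at its right end, which implies the test of [hits]. *)
Lemma hits_gt0 u v p q c n : p <= q -> {homo u : x y / x <= y} ->
  {homo v : x y / x <= y} -> u p - v p <= c -> c <= u q - v q ->
  (0 < hits u v p q c n)%N.
Proof.
move=> pq um vm cp cq.
have [i Hi] : exists i : 'I_n.+1,
    (u (cell p q n i) - v (cell p q n i) <= c) &&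
    (c <= u (cell p q n i.+1) - v (cell p q n i.+1)).
  suff: forall m, c <= u (cell p q n m.+1) - v (cell p q n m.+1) -> (m < n.+1)%N ->
    exists i : 'I_n.+1, (u (cell p q n i) - v (cell p q n i) <= c) &&
    (c <= u (cell p q n i.+1) - v (cell p q n i.+1)).
    by apply; last exact: leqnn; rewrite cell_max.
  elim=> [|m IH] cm mn; first by exists ord0; rewrite cell0 cp.
  have [cm'|cm'] := leP c (u (cell p q n m.+1) - v (cell p q n m.+1)).
    by apply: IH => //; exact: ltnW.
  by exists (Ordinal mn); rewrite /= (ltW cm').
rewrite /hits (bigD1 i)//=.
have ci : cell p q n i <= cell p q n i.+1 by apply: cell_homo.
case/andP: Hi => H1 H2; rewrite (le_trans _ H1) ?lerB ?vm//.
by rewrite (le_trans H2) ?lerB ?vm.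
Qed.

(** An upper bound for the number of solutions in [p, q[ that is measurable in all data by
    construction; the lower limit is what Fatou's lemma controls. *)
Definition crossings u v p q c : \bar R :=
  limn_einf (fun n => ((hits u v p q c n)%:R%:E : \bar R)).

Lemma hits_sum_indic u v p q c n : (hits u v p q c n)%:R%:E =
  (\sum_(i <- enum 'I_n.+1) (\1_(`[(u (cell p q n i) - v (cell p q n i.+1)),
    (u (cell p q n i.+1) - v (cell p q n i))]) c)%:E)%E :> \bar R.
Proof.
rewrite big_enum/= sumEFin /hits natr_sum; congr EFin; apply: eq_bigr => i _.
by rewrite indicE mem_setE in_itv.
Qed.

(** A cell is hit by an interval of levels whose length is the increment of [u + v] over the cell;
    the increments telescope. *)
Lemma integral_hits u v p q n (D : set R) : p <= q -> {homo u : x y / x <= y} ->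
  {homo v : x y / x <= y} -> measurable D ->
  (\int[lebesgue_measure]_(c in D) (hits u v p q c n)%:R%:E <=
   (u q - u p + (v q - v p))%:E)%E.
Proof.
move=> pq um vm mD; under eq_integral do rewrite hits_sum_indic.
rewrite ge0_integral_sum//; last first.
  by move=> i; apply/measurable_EFinP; exact: measurable_indic.
under eq_bigr do rewrite integral_indic//.
pose F i := u (cell p q n i) + v (cell p q n i).
apply: (@le_trans _ _ (\sum_(i <- enum 'I_n.+1) (F i.+1 - F i)%:E)%E).
  apply: lee_sum => i _; apply: (@le_trans _ _ (lebesgue_measure
    `[(u (cell p q n i) - v (cell p q n i.+1)),
      (u (cell p q n i.+1) - v (cell p q n i))]%classic)).
    by apply: le_measure; rewrite ?inE//; exact: measurableI.
  rewrite lebesgue_measure_itv/= lte_fin; case: ifPn => _.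
    by rewrite -EFinD lee_fin /F; lra.
  have ci : cell p q n i <= cell p q n i.+1 by apply: cell_homo.
  by rewrite lee_fin subr_ge0 lerD ?um ?vm.
rewrite big_enum/= sumEFin lee_fin.
rewrite -(big_mkord xpredT (fun i => F i.+1 - F i)) telescope_sumr//.
by rewrite /F cell0 cell_max; lra.
Qed.

Lemma crossings_ge u v p q c (s : seq R) : {homo u : x y / x <= y} ->
  {homo v : x y / x <= y} -> uniq s ->
  (forall x, x \in s -> p <= x < q /\ u x - v x = c) ->
  ((size s)%:R%:E <= crossings u v p q c)%E.
Proof.
move=> um vm su Hs; have [N HN] := hits_ge um vm su Hs.
by apply: (@le_limn_einf _ _ _ N) => n /HN; rewrite lee_fin ler_nat.
Qed.

Lemma crossings_ge0 u v p q c : (0 <= crossings u v p q c)%E.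
Proof. by apply: (@le_limn_einf _ _ _ 0%N) => n _; rewrite lee_fin. Qed.

Lemma crossings_ge1 u v p q c : p <= q -> {homo u : x y / x <= y} ->
  {homo v : x y / x <= y} -> u p - v p <= c -> c <= u q - v q ->
  (1 <= crossings u v p q c)%E.
Proof.
move=> pq um vm cp cq; apply: (@le_limn_einf _ _ _ 0%N) => n _.
by rewrite lee_fin ler1n; exact: hits_gt0.
Qed.

Lemma measurable_crossings d (T : measurableType d) (u v : T -> R -> R) p q
    (C : T -> R) :
  (forall x, measurable_fun setT (u ^~ x)) ->
  (forall x, measurable_fun setT (v ^~ x)) -> measurable_fun setT C ->
  measurable_fun setT (fun w => crossings (u w) (v w) p q (C w)).
Proof.
move=> mu mv mC.
have mh n : measurable_fun setT
    (fun w => ((hits (u w) (v w) p q (C w) n)%:R%:E : \bar R)).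
  pose A i := [set w | (u w (cell p q n i) - v w (cell p q n i.+1) <= C w) &&
    (C w <= u w (cell p q n i.+1) - v w (cell p q n i))].
  have mA i : measurable (A i).
    have : measurable_fun setT (fun w =>
        (u w (cell p q n i) - v w (cell p q n i.+1) <= C w) &&
        (C w <= u w (cell p q n i.+1) - v w (cell p q n i))).
      by apply: measurable_and; apply: measurable_fun_ler => //;
        exact: measurable_funB.
    by move=> /(_ measurableT [set true] Logic.I); rewrite setTI.
  have -> : (fun w => ((hits (u w) (v w) p q (C w) n)%:R%:E : \bar R)) =
      (fun w => \sum_(i < n.+1) (\1_(A i) w)%:E)%E.
    apply/funext => w; rewrite sumEFin /hits natr_sum; congr EFin.
    apply: eq_bigr => i _; rewrite indicE; congr (nat_of_bool _)%:R.
    by apply/idP/idP => [h|/set_mem//]; exact: mem_set.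
  apply: emeasurable_sum => i; apply/measurable_EFinP.
  exact: measurable_indic.
rewrite /crossings /limn_einf.
apply: measurableT_comp => //.
by apply: measurable_fun_limn_esup => n; exact: measurableT_comp.
Qed.

(* Banach's indicatrix argument: by Fatou, the level sets of [u - v] have on
   average at most as many points as its variation allows. *)
Lemma integral_crossings u v p q (D : set R) : p <= q ->
  {homo u : x y / x <= y} -> {homo v : x y / x <= y} -> measurable D ->
  (\int[lebesgue_measure]_(c in D) crossings u v p q c <=
   (u q - u p + (v q - v p))%:E)%E.
Proof.
move=> pq um vm mD.
have mh n : measurable_fun D (fun c => ((hits u v p q c n)%:R%:E : \bar R)).
  under eq_fun do rewrite hits_sum_indic.
  apply: emeasurable_sum => i; apply/measurable_EFinP.
  exact: measurable_indic.
have h0 n c : D c -> (0 <= ((hits u v p q c n)%:R%:E : \bar R))%E.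
  by move=> _; rewrite lee_fin.
apply: le_trans (fatou lebesgue_measure mD mh h0) _.
by apply: limn_einf_le => n; exact: integral_hits.
Qed.

End level_sets.

(** * Levels with few crossings *)

Section random_levels.
Variable R : realType.
Implicit Types (p q c x y eta : R).

Lemma null_infinite_crossings (u v : R -> R) p q (N : set R) : p <= q ->
  {homo u : x y / x <= y} -> {homo v : x y / x <= y} -> measurable N ->
  (forall c, N c -> crossings u v p q c = +oo%E) -> lebesgue_measure N = 0%E.
Proof.
move=> pq um vm mN HN; apply/eqP; rewrite eq_le measure_ge0 andbT leNgt.
apply/negP => N0.
have : (+oo * lebesgue_measure N <= (u q - u p + (v q - v p))%:E)%E.
  rewrite -integral_cst//; apply: le_trans (integral_crossings pq um vm mN).
  rewrite le_eqVlt; apply/orP; left; apply/eqP.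
  by apply: eq_integral => c /set_mem Nc /=; rewrite HN.
by rewrite gt0_mulye.
Qed.

(* Averaging over the offset [c] in ]0, 1[: there is always a crossing, and the
   total variation leaves only [eta] for the additional ones. *)
Lemma exists_good_level d (T : measurableType d) (P : probability T R)
    (D : set T) (u v : T -> R -> R) p q eta :
  measurable D -> p <= q -> 0 < eta ->
  (forall x, measurable_fun setT (u ^~ x)) ->
  (forall x, measurable_fun setT (v ^~ x)) ->
  (forall w, {homo u w : x y / x <= y}) ->
  (forall w, {homo v w : x y / x <= y}) ->
  (forall w, D w -> [/\ u w p - v w p <= 0, 1 <= u w q - v w q &
     u w q - u w p + (v w q - v w p) <= 1 + eta]) ->
  exists2 c, 0 < c < 1 & exists E, [/\ measurable E, (P E <= (2 * eta)%:E)%E &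
    forall w, D w -> ~ E w -> forall x y, p <= x < q -> p <= y < q ->
      u w x - v w x = c -> u w y - v w y = c -> x = y].
Proof.
move=> mD pq eta0 mu mv um vm HD.
pose cr c w := crossings (u w) (v w) p q c.
have mcr c : measurable_fun setT (cr c) by exact: measurable_crossings.
have cr0 c w : (0 <= cr c w)%E by exact: crossings_ge0.
(* There is at least one crossing on [D] and at least two on [E], so the mean over [D] is at least
   [P D + P E]; a bound on the mean bounds [P E]. *)
suff [c c01 Hc] : exists2 c, 0 < c < 1 &
    (\int[P]_(w in D) cr c w < P D + (2 * eta)%:E)%E.
  exists c => //; exists (D `&` [set w | (2%:E <= cr c w)%E]).
  have mE : measurable (D `&` [set w | (2%:E <= cr c w)%E]).
    apply: measurableI => //; rewrite -[X in measurable X]setTI.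
    exact: emeasurable_fun_c_infty.
  set E := D `&` _ in mE *; split=> //.
    have : (P D + P E <= \int[P]_(w in D) cr c w)%E.
      have -> : (P D + P E = \int[P]_(w in D) (cst 1 w + (\1_E w)%:E))%E.
        rewrite ge0_integralD//; last first.
          by apply/measurable_EFinP; exact: measurable_indic.
        rewrite integral_cst// mul1e integral_indic//; congr (_ + P _)%E.
        by rewrite setIC setIA setIid.
      apply: ge0_le_integral => //.
      - by move=> w _; rewrite adde_ge0// lee_fin.
      - by apply: emeasurable_funD => //; apply/measurable_EFinP; exact: measurable_indic.
      - exact: measurable_funS (mcr c).
      - move=> w Dw; have [h1 h2 _] := HD w Dw; rewrite indicE.
        case: (boolP (w \in E)) => [/set_mem[_ /= wE]|_].
          by [].
        by rewrite adde0; apply: crossings_ge1 => //; lra.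
    move=> /le_lt_trans/(_ Hc) /ltW; rewrite leeD2lE//.
    by rewrite fin_num_measure.
  move=> w Dw nEw x y xpq ypq ux uy; apply/eqP/negPn/negP => xy.
  apply: nEw; split=> //=.
  have := @crossings_ge _ (u w) (v w) p q c [:: x; y] (um w) (vm w).
  apply; first by rewrite /= inE xy.
  by move=> z; rewrite !inE => /orP[/eqP ->|/eqP ->].
(* If every offset failed, the double integral would be at least [P D + 2 * eta]; integrating over
   the offsets first, the variation bound gives at most [P D + eta]. The factor 2 makes these
   incompatible. *)
apply: contrapT => /forall2NP H.
pose A : set R := `]0, 1[%classic.
pose f (cw : R * T) := (((fun cw => cr cw.1 cw.2) \_ (A `*` D)) cw).
have mA : measurable (A : set (measurableTypeR R)) by exact: measurable_itv.
have mf : measurable_fun setT f.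
  apply/(measurable_restrictT _ (measurableX mA mD)).
  apply: measurable_funTS; apply: measurable_crossings => [x|x|] //.
  - exact: (measurableT_comp (mu x) measurable_snd).
  - exact: (measurableT_comp (mv x) measurable_snd).
have f0 cw : (0 <= f cw)%E by rewrite /f /patch; case: ifP.
have := @fubini_tonelli _ _ _ _ R lebesgue_measure P f mf f0.
have inner1 c : (\int[P]_w f (c, w) = if c \in A then \int[P]_(w in D) cr c w else 0)%E.
  case: ifPn => cA; last first.
    rewrite -[RHS](integral0 P setT); apply: eq_integral => w _.
    by rewrite /f /patch in_setX (negbTE cA).
  rewrite [RHS]integral_mkcond; apply: eq_integral => w _.
  by rewrite /f /patch in_setX cA.
have inner2 w : (\int[lebesgue_measure]_c f (c, w) =
    if w \in D then \int[lebesgue_measure]_(c in A) cr c w else 0)%E.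
  case: ifPn => wD; last first.
    rewrite -[RHS](integral0 lebesgue_measure setT); apply: eq_integral => c _.
    by rewrite /f /patch in_setX (negbTE wD) andbF.
  rewrite [RHS]integral_mkcond; apply: eq_integral => c _.
  by rewrite /f /patch in_setX wD andbT.
have PDfin : P D \is a fin_num by rewrite fin_num_measure.
have A1 : lebesgue_measure A = 1%E.
  by rewrite lebesgue_measure_itv/= lte_fin ltr01 -EFinB subr0.
have lb : (P D + (2 * eta)%:E <= \int[lebesgue_measure]_c \int[P]_w f (c, w))%E.
  have -> : (P D + (2 * eta)%:E =
      \int[lebesgue_measure]_(c in A) cst (P D + (2 * eta)%:E) c)%E.
    by rewrite integral_cst// -[LHS]mule1 -A1.
  rewrite integral_mkcond; apply: ge0_le_integral => //.
  - move=> c _; rewrite /patch; case: ifP => // _.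
    by rewrite adde_ge0// lee_fin mulr_ge0// ltW.
  - exact/(measurable_restrictT _ mA).
  - exact: measurable_fun_fubini_tonelli_F.
  - move=> c _; rewrite inner1 /patch; case: ifPn => // /set_mem; rewrite /A /= in_itv/= => cA.
    by have [//|/negP] := H c; rewrite -leNgt.
have ub : (\int[P]_w \int[lebesgue_measure]_c f (c, w) <= P D + eta%:E)%E.
  apply: (@le_trans _ _ (\int[P]_(w in D) cst (1 + eta)%:E w)%E).
    rewrite [leRHS]integral_mkcond; apply: ge0_le_integral => //.
    - by move=> w _; apply: integral_ge0.
    - exact: measurable_fun_fubini_tonelli_G.
    - exact/(measurable_restrictT _ mD).
    - move=> w _; rewrite inner2 /patch; case: ifPn => // /set_mem Dw.
      have [_ _ h] := HD w Dw.
      by apply: le_trans (integral_crossings pq (um w) (vm w) mA) _; rewrite lee_fin.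
  rewrite integral_cst// EFinD ge0_muleDl ?lee_fin ?ler01 ?(ltW eta0)// mul1e.
  rewrite leeD2l// -[leRHS]mule1 lee_wpmul2l ?lee_fin ?(ltW eta0)//.
  exact: probability_le1.
move=> E; move: lb; rewrite E => /le_trans/(_ ub); rewrite leeD2lE// lee_fin.
by apply/negP; rewrite -ltNge; lra.
Qed.

End random_levels.

(** * Homeomorphisms of the unit interval in the logistic chart *)

Section chart.
Variable R : realType.
Local Notation I := (unit_interval R).
Implicit Types (f g h k : homeo R) (x y z t : R) (u w : I).

Definition sigm x : R := (1 + expR (- x))^-1.
Definition logit y : R := - ln (y^-1 - 1).

Lemma sigm_itv x : 0 < sigm x < 1.
Proof.
have e0 := expR_gt0 (- x).
by rewrite invr_gt0 addr_gt0//= invf_lt1 ?ltrDl// addr_gt0.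
Qed.

Lemma sigm_lt : {mono sigm : x y / x < y}.
Proof.
apply/leW_mono/le_mono => x y xy.
by rewrite ltf_pV2 ?posrE ?addr_gt0 ?expR_gt0// ltrD2l ltr_expR ltrN2.
Qed.

Lemma sigmK : cancel sigm logit.
Proof. by move=> x; rewrite /logit /sigm invrK addrC addKr expRK opprK. Qed.

Lemma logitK y : 0 < y < 1 -> sigm (logit y) = y.
Proof.
move=> /andP[y0 y1]; rewrite /sigm /logit opprK lnK ?subrKC ?invrK//.
by rewrite posrE subr_gt0 invf_gt1.
Qed.

(** The chart contracts distances, so closeness on the line passes to the uniform metric; in
    particular [flow] is continuous. *)
Lemma sigm_lipschitz x y : x <= y -> sigm y - sigm x <= y - x.
Proof.
move=> xy; have a0 := expR_gt0 (- x).
have yE : expR (- y) = expR (- x) * expR (- (y - x)).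
  by rewrite -expRD; congr expR; ring.
have d1 : 1 - (y - x) <= expR (- (y - x)) by exact: expR_ge1Dx.
have d0 := expR_gt0 (- (y - x)).
have d2 : expR (- (y - x)) <= 1 by rewrite -expR0 ler_expR; lra.
rewrite /sigm yE; set a := expR (- x) in a0 *.
set b := expR (- (y - x)) in d0 d1 d2 *.
have ab0 : 0 < a * b by rewrite mulr_gt0.
have -> : (1 + a * b)^-1 - (1 + a)^-1 = a * (1 - b) / ((1 + a * b) * (1 + a)).
  by field; rewrite !gt_eqF// addr_gt0.
apply: (@le_trans _ _ (1 - b)); last by lra.
rewrite ler_pdivrMr ?mulr_gt0 ?addr_gt0// mulrC ler_wpM2l ?subr_ge0//.
by nra.
Qed.

Lemma toI_subproof x : sigm x \in (`[0 : R, 1]%classic : set R).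
Proof.
by apply/mem_set; rewrite /= in_itv/=; have /andP[s0 s1] := sigm_itv x; rewrite !ltW.
Qed.

Definition toI x : I := SigSub (toI_subproof x).

Lemma val_itv u : 0 <= val u <= 1.
Proof. by have := set_valP u; rewrite /= in_itv. Qed.

Lemma toIK u : 0 < val u < 1 -> toI (logit (val u)) = u.
Proof. by move=> u01; apply: val_inj; rewrite /= logitK. Qed.

Lemma homeo_lt f u w : (val (f u) < val (f w)) = (val u < val w).
Proof.
have [_ _ fm] := homeoP f; apply/idP/idP; last exact: fm.
move=> fuw; rewrite ltNge; apply/negP; rewrite le_eqVlt => /orP[/eqP|].
  by move=> /val_inj e; rewrite e ltxx in fuw.
by move=> /fm; rewrite ltNge (ltW fuw).
Qed.

Lemma homeo_itv f u : (0 < val (f u) < 1) = (0 < val u < 1).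
Proof.
have key h w : 0 < val w < 1 -> 0 < val (h w) < 1.
  move=> w01; rewrite -(toIK w01); set x := logit _; apply/andP; split.
    apply: (@le_lt_trans _ _ (val (h (toI (x - 1))))).
      by have /andP[] := val_itv (h (toI (x - 1))).
    by rewrite homeo_lt /= sigm_lt; lra.
  apply: (@lt_le_trans _ _ (val (h (toI (x + 1))))).
    by rewrite homeo_lt /= sigm_lt; lra.
  by have /andP[] := val_itv (h (toI (x + 1))).
apply/idP/idP; last exact: key.
by move=> /(key (homeo_inv f)); rewrite homeoK.
Qed.

Lemma homeo_end f u : ~~ (0 < val u < 1) -> f u = u.
Proof.
move=> u01; apply: val_inj; apply/eqP; rewrite eq_le.
have /andP[u0 u1] := val_itv u; have /andP[f0 f1] := val_itv (f u).
have /andP[v0 v1] := val_itv (homeo_inv f u).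
have leE w : (val (f w) <= val u) = (val w <= val (homeo_inv f u)).
  by rewrite -[in LHS](homeoVK f u) leNgt homeo_lt -leNgt.
have geE w : (val u <= val (f w)) = (val (homeo_inv f u) <= val w).
  by rewrite -[in LHS](homeoVK f u) leNgt homeo_lt -leNgt.
rewrite leE geE; move: u01; rewrite negb_and -!leNgt => /orP[u0'|u1'].
  have uE : val u = 0 by apply/eqP; rewrite eq_le u0' u0.
  by rewrite -leE -geE uE f0 andbT -[leRHS]uE leE uE v0.
have uE : val u = 1 by apply/eqP; rewrite eq_le u1' u1.
by rewrite -leE -geE uE f1 /= -[leLHS]uE geE uE v1.
Qed.

Definition hat f x : R := logit (val (f (toI x))).

Lemma toI_hat f x : toI (hat f x) = f (toI x).
Proof. by rewrite toIK// homeo_itv sigm_itv. Qed.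

Lemma toI_inj : injective toI.
Proof. by move=> x y /(congr1 val) /= /(congr1 logit); rewrite !sigmK. Qed.

Lemma hat_mul f g x : hat (f * g)%g x = hat f (hat g x).
Proof. by apply: toI_inj; rewrite !toI_hat. Qed.

Lemma hat_invK f : cancel (hat f) (hat f^-1%g).
Proof.
by move=> x; rewrite -hat_mul; apply: toI_inj; rewrite toI_hat mulVg.
Qed.

Lemma hatK_inv f : cancel (hat f^-1%g) (hat f).
Proof.
by move=> x; rewrite -hat_mul; apply: toI_inj; rewrite toI_hat mulgV.
Qed.

Lemma hat_incbij f : incbij (hat f).
Proof.
split; last by move=> y; exists (hat f^-1%g y); rewrite hatK_inv.
move=> x y xy; rewrite -sigm_lt.
have hatE z : sigm (hat f z) = val (f (toI z)) by rewrite -toI_hat.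
by rewrite !hatE homeo_lt /= sigm_lt.
Qed.

Lemma hat_inj f g : hat f =1 hat g -> f = g.
Proof.
move=> fg; apply: eq_homeo => u.
have [u01|u01] := boolP (0 < val u < 1); last by rewrite !homeo_end.
by rewrite -(toIK u01) -!toI_hat fg.
Qed.

Lemma nbhs_unit_interval u (P : set I) : nbhs u P <->
  exists2 e, 0 < e & forall w, `|val w - val u| < e -> P w.
Proof.
split=> [|[e e0 eP]].
  rewrite nbhsE => -[_ [[C oC <-] Cu] CP].
  have /nbhs_ballP[e /= e0 eC] := open_nbhs_nbhs (conj oC Cu).
  by exists e => // w wu; apply: CP; apply: eC; rewrite /ball/= distrC.
have cval : continuous (val : I -> R) by exact: initial_continuous.
have /(cval u) : nbhs (val u) (ball (val u) e) by exact: nbhsx_ballx.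
apply: (@filterS I (nbhs u)) => w /= uw.
by apply: eP; move: uw; rewrite /ball/= distrC.
Qed.

(** A strictly increasing surjection is continuous, because the values bounding a neighbourhood of
    an image are attained; its inverse is again such a surjection. *)
Lemma increasing_surj_homeo (F : I -> I) :
  {homo F : x y / val x < val y} -> (forall u, exists w, F w = u) ->
  increasing_homeo F.
Proof.
have cont (G : I -> I) : {homo G : x y / val x < val y} ->
    (forall u, exists w, G w = u) -> continuous G.
  move=> Gm Gs.
  have Gmono (x y : I) : val (G x) < val (G y) -> val x < val y.
    move=> Gxy; rewrite ltNge le_eqVlt; apply/negP => /orP[/eqP/val_inj e|/Gm].
      by rewrite e ltxx in Gxy.
    by rewrite ltNge (ltW Gxy).
  have upper u c : val (G u) < c ->
      exists2 e, 0 < e & forall w, `|val w - val u| < e -> val (G w) < c.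
    move=> uc; have [c1|c1] := ltP 1 c.
      exists 1 => // w _; apply: le_lt_trans c1.
      by have /andP[] := val_itv (G w).
    have c01 : c \in (`[0, 1]%classic : set R).
      apply/mem_set; rewrite /= in_itv/= c1 andbT.
      by have /andP[h _] := val_itv (G u); exact: ltW (le_lt_trans h uc).
    have [a aE] := Gs (SigSub c01).
    have cE : c = val (G a) by rewrite aE.
    exists (val a - val u) => [|w]; first by rewrite subr_gt0 Gmono// -cE.
    by rewrite ltr_distl => /andP[_]; rewrite subrKC cE; exact: Gm.
  have lower u c : c < val (G u) ->
      exists2 e, 0 < e & forall w, `|val w - val u| < e -> c < val (G w).
    move=> cu; have [c0|c0] := ltP c 0.
      exists 1 => // w _; apply: (lt_le_trans c0).
      by have /andP[] := val_itv (G w).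
    have c01 : c \in (`[0, 1]%classic : set R).
      apply/mem_set; rewrite /= in_itv/= c0 /=.
      by have /andP[_ h] := val_itv (G u); exact: ltW (lt_le_trans cu h).
    have [a aE] := Gs (SigSub c01).
    have cE : c = val (G a) by rewrite aE.
    exists (val u - val a) => [|w]; first by rewrite subr_gt0 Gmono// -cE.
    by rewrite ltr_distl => /andP[+ _]; rewrite subKr cE; exact: Gm.
  move=> u P /nbhs_unit_interval[e e0 eP].
  have [d1 d10 H1] := upper u _ (ltr_pwDr e0 (lexx (val (G u)))).
  have [|d2 d20 H2] := lower u (val (G u) - e); first by rewrite ltrBlDr ltrDl.
  apply/nbhs_unit_interval; exists (Num.min d1 d2); first by rewrite lt_min d10.
  move=> w; rewrite lt_min => /andP[/H1 w1 /H2 w2]; apply: eP.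
  by rewrite ltr_distl w2 w1.
move=> Fm Fs; have [G FG] := choice Fs.
have GF : cancel F G.
  move=> x; apply: val_inj; case: (ltgtP (val (G (F x))) (val x)) => // /Fm;
  by rewrite FG ltxx.
split=> //; first exact: cont.
exists G; split=> //; apply: cont => [x y xy|u]; last by exists (F u).
rewrite ltNge le_eqVlt; apply/negP => /orP[/eqP/val_inj e|/Fm].
  by move: xy; rewrite -(FG x) -(FG y) e ltxx.
by rewrite !FG ltNge (ltW xy).
Qed.

Lemma homeo_of_incbij (F : R -> R) : incbij F -> exists f, hat f =1 F.
Proof.
move=> bF.
pose G u : I := if 0 < val u < 1 then toI (F (logit (val u))) else u.
have GE x : G (toI x) = toI (F x) by rewrite /G /= sigm_itv sigmK.
have Gend u : ~~ (0 < val u < 1) -> G u = u by rewrite /G => /negbTE ->.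
have hG : increasing_homeo G.
  apply: increasing_surj_homeo => [u w uw|u]; last first.
    have [u01|u01] := boolP (0 < val u < 1); last by exists u; exact: Gend.
    have [x xE] := bF.2 (logit (val u)).
    by exists (toI x); rewrite GE xE toIK.
  have /andP[u0 u1] := val_itv u; have /andP[w0 w1] := val_itv w.
  have [u01|u01] := boolP (0 < val u < 1).
    have [w01|w01] := boolP (0 < val w < 1).
      move: uw; rewrite -(toIK u01) -(toIK w01) !GE /= !sigm_lt.
      by rewrite (incbij_lt bF).
    rewrite (Gend w)// -(toIK u01) GE /=; apply: lt_le_trans (_ : 1 <= _).
      by have /andP[] := sigm_itv (F (logit (val u))).
    by move: w01; rewrite (le_lt_trans u0 uw)/= -leNgt.
  rewrite (Gend u)//.
  have uE : val u <= 0.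
    by rewrite leNgt; apply/negP => u0'; move: u01; rewrite u0' (lt_le_trans uw).
  have [w01|w01] := boolP (0 < val w < 1); last by rewrite (Gend w).
  rewrite -(toIK w01) GE /=; apply: le_lt_trans uE _.
  by have /andP[] := sigm_itv (F (logit (val w))).
exists (SigSub (mem_set hG) : homeo R) => x.
by apply: toI_inj; rewrite toI_hat -GE.
Qed.

Lemma conjugate_conj_class f g :
  conjugate (hat f) (hat g) -> conj_class f g.
Proof.
move=> [c [bc cE]]; have [h hE] := homeo_of_incbij bc.
exists h => //; apply: hat_inj => x; rewrite !hat_mul hE cE -hE.
by rewrite hatK_inv.
Qed.

Lemma conj_class_conjugate f g :
  conj_class f g -> conjugate (hat f) (hat g).
Proof.
move=> [h _ <-]; exists (hat h); split=> [|x]; first exact: hat_incbij.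
by rewrite !hat_mul hat_invK.
Qed.

End chart.

Lemma negligible_bigcup_countable d (T : measurableType d) (R : realType)
    (mu : measure T R) (X : countType) (F : X -> set T) :
  (forall x, mu.-negligible (F x)) -> mu.-negligible (\bigcup_x F x).
Proof.
move=> HF.
pose F' n := if (unpickle n : option X) is Some x then F x else set0.
have nF n : mu.-negligible (F' n).
  by rewrite /F'; case: unpickle => [x|]; [exact: HF|exact: negligible_set0].
apply: negligibleS (negligible_bigcup nF) => t [x _ Fxt].
by exists (pickle x) => //; rewrite /F' pickleK.
Qed.

(** * Borel structure of the homeomorphism group *)

Section borel_homeo.
Variable R : realType.
Local Notation I := (unit_interval R).
Local Notation Gb := (g_sigma_algebraType (@open (homeo R))).
Implicit Types (f g h k b : homeo R) (x y z t : R) (u w : I).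

Lemma borel_measurable_fun d (T : measurableType d) (phi : T -> Gb) :
  (forall U : set (homeo R), open U -> d.-measurable (phi @^-1` U)) ->
  measurable_fun setT phi.
Proof.
move=> H; refine (@measurability d _ T Gb setT phi (@open (homeo R)) _ _) => //.
by move=> _ [U oU <-]; rewrite setTI; exact: H.
Qed.

Lemma open_borel (U : set (homeo R)) : open U -> measurable (U : set Gb).
Proof. by move=> oU; exact: sub_sigma_algebra. Qed.

Lemma ball_unit_interval u e w : ball u e w <-> `|val u - val w| < e.
Proof. by []. Qed.

Lemma hat_gt f x t : (t < hat f x) = (sigm t < val (f (toI x))).
Proof. by rewrite -toI_hat /= sigm_lt. Qed.

Lemma hat_lt f x t : (hat f x < t) = (val (f (toI x)) < sigm t).
Proof. by rewrite -toI_hat /= sigm_lt. Qed.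

Lemma open_hat_gt x t : open [set f : homeo R | t < hat f x].
Proof.
rewrite openE => f /= tx; apply/nbhs_homeo.
exists (val (homeo_fun f (toI x)) - sigm t).
  by rewrite subr_gt0 -hat_gt.
move=> g /(_ (toI x))/ball_unit_interval; rewrite ltr_distlC /= hat_gt => /andP[+ _].
by rewrite subKr.
Qed.

Lemma open_hat_lt x t : open [set f : homeo R | hat f x < t].
Proof.
rewrite openE => f /= tx; apply/nbhs_homeo.
exists (sigm t - val (homeo_fun f (toI x))).
  by rewrite subr_gt0 -hat_lt.
move=> g /(_ (toI x))/ball_unit_interval; rewrite ltr_distlC /= hat_lt => /andP[_].
by rewrite subrKC.
Qed.

Lemma measurable_hat x : measurable_fun setT (fun f : Gb => hat f x).
Proof.
refine (@measurability _ _ Gb _ setT _ (@RGenOInfty.G R) _ _).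
  exact: RGenOInfty.measurableE.
move=> _ [_ [t ->] <-]; rewrite setTI; apply: open_borel.
rewrite [X in open X](_ : _ = [set f : homeo R | t < hat f x]).
  exact: open_hat_gt.
by apply/seteqP; split=> f /=; rewrite in_itv/= andbT.
Qed.

Lemma measurable_translation g h :
  measurable_fun setT (fun k : Gb => (g * k * h)%g : Gb).
Proof.
apply: borel_measurable_fun => U oU; apply: open_borel.
rewrite openE => k /= Uk; have /nbhs_homeo[e e0 eU] := open_nbhs_nbhs (conj oU Uk).
have /filter_ex[d [d0 gd]] : \forall d \near 0^'+, 0 < d /\
    forall x y : I, ball x d y -> ball (g x) e (g y).
  by near=> d; split=> //; near: d; exact: homeo_unif_continuous.
apply/nbhs_homeo; exists d => // k' kk'; apply: eU => u.
by apply: gd; exact: kk'.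
Unshelve. all: by end_near. Qed.

Lemma translateE g h (B : set (homeo R)) :
  translate g h B = [set k | B (g^-1 * k * h^-1)%g].
Proof.
apply/seteqP; split=> [_ [b Bb <-]|k Bk] /=.
  by rewrite !mulgA mulVg mul1g -mulgA mulgV mulg1.
by exists (g^-1 * k * h^-1)%g => //; rewrite !mulgA mulgV mul1g -mulgA mulVg mulg1.
Qed.

Lemma measurable_translate g h (B : set (homeo R)) : borel_set B ->
  measurable (translate g h B : set Gb).
Proof.
move=> mB; rewrite translateE.
have := measurable_translation g^-1%g h^-1%g measurableT mB.
by rewrite setTI.
Qed.

Lemma translation_subproof t : incbij (fun x => x + t).
Proof.
by split=> [x y xy|y]; [rewrite ltrD2r|exists (y - t); rewrite subrK].
Qed.

Definition flow t : homeo R :=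
  projT1 (cid (homeo_of_incbij (translation_subproof t))).

Lemma hat_flow t x : hat (flow t) x = x + t.
Proof. by rewrite /flow; case: cid => /= f ->. Qed.

Lemma measurable_flow :
  measurable_fun (setT : set (measurableTypeR R)) (flow : _ -> Gb).
Proof.
apply: borel_measurable_fun => U oU.
apply: open_measurable; rewrite openE => t /= Ut.
have /nbhs_homeo[e e0 eU] := open_nbhs_nbhs (conj oU Ut).
apply/nbhs_ballP; exists e => //= s; rewrite /ball/= => ts.
apply: eU => u; apply/ball_unit_interval.
have [u01|u01] := boolP (0 < val u < 1); last first.
  by rewrite !(homeo_end _ u01) subrr normr0.
rewrite -(toIK u01) -!toI_hat !hat_flow /=; set x := logit _.
have lip y z : y <= z -> `|sigm y - sigm z| <= `|y - z|.
  move=> yz; rewrite distrC (distrC y) !ger0_norm ?subr_ge0// ?sigm_lipschitz//.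
  by rewrite leNgt sigm_lt -leNgt.
apply: (@le_lt_trans _ _ `|t - s|) => //.
have -> : t - s = (x + t) - (x + s) by ring.
have [ts'|/ltW ts'] := leP (x + t) (x + s); first exact: lip.
by rewrite distrC (distrC (x + t)); exact: lip.
Qed.

End borel_homeo.

(** * Haar nullness of the non-crossing homeomorphisms *)

Section non_crossing_null.
Variable R : realType.
Local Notation Gb := (g_sigma_algebraType (@open (homeo R))).
Implicit Types (f g h k b : homeo R) (p q x y z t : R).

(** A superset of the maps with infinitely many fixed points in [-n, n[: [crossings] only bounds
    their number from above, but is Borel in [f]. *)
Definition infinite_fix (n : nat) : set (homeo R) :=
  [set f | crossings id (hat f) (- n%:R) n%:R 0 = +oo%E].

(** Given the first clause, the second amounts by compactness to a fixed point in [p, q]; in this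
    form it is a countable intersection of open conditions. *)
Definition touch_above p q : set (homeo R) :=
  [set f | (forall x, p <= x <= q -> x <= hat f x) /\
    forall m : nat, exists x, p <= x <= q /\ hat f x < x + m.+1%:R^-1].

Definition touch_below p q : set (homeo R) :=
  [set f | (forall x, p <= x <= q -> hat f x <= x) /\
    forall m : nat, exists x, p <= x <= q /\ x - m.+1%:R^-1 < hat f x].

Definition non_crossing : set (homeo R) :=
  (\bigcup_n infinite_fix n) `|`
  \bigcup_(pq : rat * rat) (touch_above (ratr pq.1) (ratr pq.2) `|`
                            touch_below (ratr pq.1) (ratr pq.2)).

Lemma hat_homo f : {homo hat f : x y / x <= y}.
Proof. by move=> x y; rewrite (incbij_le (hat_incbij f)). Qed.

(** Near the limit point there are arbitrarily long lists of fixed points, each closer to it than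
    the preceding one and hence new. *)
Lemma has_limit_fix_infinite f :
  has_limit_fix (hat f) -> exists n, infinite_fix n f.
Proof.
move=> [z Hz].
have Hs (K : nat) e : 0 < e -> exists s : seq R, [/\ uniq s, size s = K &
    forall x, x \in s -> `|x - z| < e /\ hat f x = x].
  elim: K e => [|K IH] e e0; first by exists [::].
  have [x [xz xe fx]] := Hz e e0.
  have d0 : 0 < `|x - z| by rewrite normr_gt0 subr_eq0.
  have [s [su sK Hs]] := IH _ d0; exists (x :: s); split=> /=.
  - by rewrite su andbT; apply/negP => /Hs[]; rewrite ltxx.
  - by rewrite sK.
  - move=> y; rewrite inE => /orP[/eqP ->//|/Hs[yx fy]]; split=> //.
    exact: lt_trans xe.
exists (Num.Def.archi_bound (`|z| + 1)); set n := Num.Def.archi_bound _.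
have zn : `|z| + 1 < n%:R by apply: archi_boundP; rewrite addr_ge0.
apply/eqyP => A A0.
have [s [su sK sz]] := Hs (Num.Def.archi_bound A) 1 ltr01.
apply: (@le_trans _ _ (size s)%:R%:E).
  by rewrite sK lee_fin ltW// archi_boundP// ltW.
apply: crossings_ge => // [|x xs]; first exact: hat_homo.
have [xz fx] := sz x xs; split; last by rewrite fx subrr.
have : `|x| < n%:R.
  apply: le_lt_trans zn; rewrite -[x](subrK z) addrC.
  by apply: (le_trans (ler_normD _ _)); rewrite lerD2l ltW.
by rewrite ltr_norml => /andP[/ltW -> ->].
Qed.

Lemma touches_touch f : touches (hat f) -> exists pq : rat * rat,
  (touch_above (ratr pq.1) (ratr pq.2) `|` touch_below (ratr pq.1) (ratr pq.2)) f.
Proof.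
move=> [z [fz [e e0 He]]].
have ze : z - e < z by rewrite ltrBlDr ltrDl.
have ez : z < z + e by rewrite ltrDl.
have [p] := rat_in_itvoo ze; rewrite in_itv/= => /andP[p1 p2].
have [q] := rat_in_itvoo ez; rewrite in_itv/= => /andP[q1 q2].
have pqe x : ratr p <= x <= ratr q -> `|x - z| < e.
  by move=> /andP[x1 x2]; rewrite ltr_distl; apply/andP; split; lra.
have pzq : ratr p <= z <= ratr q by rewrite !ltW.
exists (p, q); case: He => He; [left|right]; split=> /=.
- by move=> x /pqe/He.
- by move=> m; exists z; rewrite fz ltrDl invr_gt0 ltr0n.
- by move=> x /pqe/He.
- by move=> m; exists z; rewrite fz ltrBlDr ltrDl invr_gt0 ltr0n.
Qed.

Lemma non_crossing_hat f :
  has_limit_fix (hat f) \/ touches (hat f) -> non_crossing f.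
Proof.
move=> [/has_limit_fix_infinite[n fn]|/touches_touch[pq fpq]].
  by left; exists n.
by right; exists pq.
Qed.

(** The unions over the points of an interval are uncountable, but their members are open; all other
    operations are countable. *)
Lemma borel_non_crossing : borel_set non_crossing.
Proof.
have mlt p q (c : R -> R) :
    measurable ([set f | exists x, p <= x <= q /\ hat f x < c x] : set Gb).
  rewrite (_ : [set f | _] = \bigcup_(x in [set x | p <= x <= q])
      [set f : homeo R | hat f x < c x]).
    have := @bigcup_open (homeo R) _ [set x | p <= x <= q]
      (fun x => [set f : homeo R | hat f x < c x]).
    by move=> /(_ (fun x _ => open_hat_lt x (c x)))/open_borel.
  apply/seteqP; split=> f /=; first by move=> [x [xpq fx]]; exists x.
  by move=> [x xpq fx]; exists x.
have mgt p q (c : R -> R) :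
    measurable ([set f | exists x, p <= x <= q /\ c x < hat f x] : set Gb).
  rewrite (_ : [set f | _] = \bigcup_(x in [set x | p <= x <= q])
      [set f : homeo R | c x < hat f x]).
    have := @bigcup_open (homeo R) _ [set x | p <= x <= q]
      (fun x => [set f : homeo R | c x < hat f x]).
    by move=> /(_ (fun x _ => open_hat_gt x (c x)))/open_borel.
  apply/seteqP; split=> f /=; first by move=> [x [xpq fx]]; exists x.
  by move=> [x xpq fx]; exists x.
suff : measurable (non_crossing : set Gb) by [].
apply: measurableU.
  apply: bigcupT_measurable => n.
  have : measurable_fun setT (fun f : Gb => crossings id (hat f) (- n%:R) n%:R 0).
    apply: (@measurable_crossings R _ Gb (fun _ => id) (fun f => hat f)) => // x.
    exact: measurable_hat.
  by move=> /(_ measurableT _ (emeasurable_set1 +oo)); rewrite setTI.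
apply: countable_bigcupT_measurable => // pq; apply: measurableU.
  rewrite (_ : touch_above _ _ =
    ~` [set f | exists x, ratr pq.1 <= x <= ratr pq.2 /\ hat f x < x] `&`
    \bigcap_m [set f | exists x, ratr pq.1 <= x <= ratr pq.2 /\
      hat f x < x + m.+1%:R^-1]).
    apply: measurableI; first exact: measurableC (mlt _ _ id).
    by apply: bigcapT_measurable => m; exact: (mlt _ _ (fun x => x + _)).
  apply/seteqP; split=> f [fge Hm]; split=> //.
  - by move=> [x [/fge xf]]; rewrite ltNge xf.
  - by move=> m _; exact: Hm.
  - by move=> x xpq; rewrite leNgt; apply/negP => fx; apply: fge; exists x.
  - by move=> m; exact: (Hm m I).
rewrite (_ : touch_below _ _ =
  ~` [set f | exists x, ratr pq.1 <= x <= ratr pq.2 /\ x < hat f x] `&`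
  \bigcap_m [set f | exists x, ratr pq.1 <= x <= ratr pq.2 /\
    x - m.+1%:R^-1 < hat f x]).
  apply: measurableI; first exact: measurableC (mgt _ _ id).
  by apply: bigcapT_measurable => m; exact: (mgt _ _ (fun x => x - _)).
apply/seteqP; split=> f [fge Hm]; split=> //.
- by move=> [x [/fge xf]]; rewrite ltNge xf.
- by move=> m _; exact: Hm.
- by move=> x xpq; rewrite leNgt; apply/negP => fx; apply: fge; exists x.
- by move=> m; exact: (Hm m I).
Qed.

Lemma zero_of_small_values (F : R -> R) p q : continuous F ->
  (forall x, p <= x <= q -> 0 <= F x) ->
  (forall m : nat, exists x, p <= x <= q /\ F x < m.+1%:R^-1) ->
  exists2 x, p <= x <= q & F x = 0.
Proof.
move=> cF F0 Fm; have [x0 [/andP[px0 xq0] _]] := Fm 0%N.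
have [x] := EVT_min (le_trans px0 xq0) (continuous_subspaceT cF).
rewrite in_itv/= => xpq xmin; exists x => //.
apply/eqP; rewrite eq_le F0// andbT leNgt; apply/negP => Fx0.
have [y [ypq Fy]] := Fm (Num.Def.archi_bound (F x)^-1).
have : F x <= F y by apply: xmin; rewrite in_itv.
apply/negP; rewrite -ltNge; apply: (lt_trans Fy).
rewrite invf_plt ?posrE//.
apply: (lt_trans (archi_boundP _)); first by rewrite invr_ge0 ltW.
by rewrite ltr_nat.
Qed.

Lemma hat_continuous f : continuous (hat f).
Proof. exact/incbij_continuous/hat_incbij. Qed.

Lemma touch_above_fix f p q : touch_above p q f ->
  exists2 x, p <= x <= q & hat f x = x.
Proof.
move=> [fge Hm].
have [|x|m|x xpq /eqP] := @zero_of_small_values (fun x => hat f x - x) p q.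
- by move=> x; apply: cvgB; [exact: hat_continuous|exact: cvg_id].
- by move=> /fge; rewrite subr_ge0.
- by have [x [xpq fx]] := Hm m; exists x; rewrite ltrBlDl.
- by rewrite subr_eq0 => /eqP; exists x.
Qed.

Lemma touch_below_fix f p q : touch_below p q f ->
  exists2 x, p <= x <= q & hat f x = x.
Proof.
move=> [fge Hm].
have [|x|m|x xpq /eqP] := @zero_of_small_values (fun x => x - hat f x) p q.
- by move=> x; apply: cvgB; [exact: cvg_id|exact: hat_continuous].
- by move=> /fge; rewrite subr_ge0.
- by have [x [xpq fx]] := Hm m; exists x; rewrite ltrBlDl -ltrBlDr.
- by rewrite subr_eq0 => /eqP/esym; exists x.
Qed.

Lemma negligible_subsingleton (N : set R) :
  (forall s t, N s -> N t -> s = t) -> lebesgue_measure.-negligible N.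
Proof.
move=> H; have [->|/set0P[t Nt]] := eqVneq N set0; first exact: negligible_set0.
exists [set t]; split=> [//||s Ns]; first exact: lebesgue_measure_set1.
by rewrite (H s t).
Qed.

Lemma hat_mulEfix g h t x :
  ((x <= hat (g * flow t * h)%g x) = (hat g^-1%g x - hat h x <= t)) *
  ((hat (g * flow t * h)%g x <= x) = (t <= hat g^-1%g x - hat h x)).
Proof.
have E y z : (y <= z) = (hat g^-1%g y <= hat g^-1%g z).
  by rewrite (incbij_le (hat_incbij _)).
rewrite !hat_mul hat_flow (E x) (E _ x) (hat_invK g) lerBlDl; split=> //.
by rewrite lerBrDl.
Qed.

(** Applying the inverse of [g] turns each cell test for fixed points into the test for level [t],
    so even the counts [hits] coincide. *)
Lemma crossings_flow g h t p q :
  crossings id (hat (g * flow t * h)%g) p q 0 =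
  crossings (hat g^-1%g) (hat h) p q t.
Proof.
have E y z : (y <= z) = (hat g^-1%g y <= hat g^-1%g z).
  by rewrite (incbij_le (hat_incbij _)).
have bE x : hat (g * flow t * h)%g x = hat g (hat h x + t).
  by rewrite !hat_mul hat_flow.
congr limn_einf; apply/funext => n; congr (_%:R%:E); apply: eq_bigr => i _.
rewrite subr_le0 subr_ge0 !bE (E (cell _ _ _ _)) (E (hat g _)) !(hat_invK g).
by rewrite lerBlDl lerBrDl.
Qed.

Lemma negligible_translates g h : lebesgue_measure.-negligible
  [set t | non_crossing (g * flow t * h)%g].
Proof.
rewrite [X in _.-negligible X](_ : _ =
    (\bigcup_n [set t | infinite_fix n (g * flow t * h)%g]) `|`
    \bigcup_(pq : rat * rat) ([set t | touch_above (ratr pq.1) (ratr pq.2) (g * flow t * h)%g] `|`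
      [set t | touch_below (ratr pq.1) (ratr pq.2) (g * flow t * h)%g])); last first.
  apply/seteqP; split=> t /=.
    by move=> [[n _ fn]|[pq _ fpq]]; [left; exists n|right; exists pq].
  by move=> [[n _ fn]|[pq _ fpq]]; [left; exists n|right; exists pq].
apply: negligibleU.
  apply: negligible_bigcup => n.
  have NE : [set t | infinite_fix n (g * flow t * h)%g] =
      [set t | crossings (hat g^-1%g) (hat h) (- n%:R) n%:R t = +oo%E].
    by apply/seteqP; split=> t; rewrite /infinite_fix /= crossings_flow.
  rewrite NE; set N := [set t | _].
  have mN : measurable (N : set (measurableTypeR R)).
    have : measurable_fun setT (fun t : measurableTypeR R =>
        crossings (hat g^-1%g) (hat h) (- n%:R) n%:R t).
      exact: (@measurable_crossings R _ _ (fun _ => hat g^-1%g) (fun _ => hat h)).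
    by move=> /(_ measurableT _ (emeasurable_set1 +oo)); rewrite setTI.
  exists N; split=> //.
  apply: (@null_infinite_crossings _ (hat g^-1%g) (hat h) (- n%:R) n%:R) => //.
  - by rewrite lerNl (le_trans _ (ler0n _ _))// oppr_le0 ler0n.
  - exact: hat_homo.
  - exact: hat_homo.
apply: negligible_bigcup_countable => -[p q] /=; apply: negligibleU;
  apply: negligible_subsingleton => s t /= Hs Ht.
  (* The fixed point for one parameter, tested in the inequality for the other, yields [s <= t] and
     [t <= s]. *)
  have [x xpq fx] := touch_above_fix Hs; have [y ypq fy] := touch_above_fix Ht.
  have := Ht.1 x xpq; have := Hs.1 y ypq.
  move/eqP: fx; move/eqP: fy; rewrite !eq_le !hat_mulEfix.
  by move=> /andP[? ?] /andP[? ?] ? ?; lra.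
have [x xpq fx] := touch_below_fix Hs; have [y ypq fy] := touch_below_fix Ht.
have := Ht.1 x xpq; have := Hs.1 y ypq.
move/eqP: fx; move/eqP: fy; rewrite !eq_le !hat_mulEfix.
by move=> /andP[? ?] /andP[? ?] ? ?; lra.
Qed.

Lemma haar_null_non_crossing : haar_null R non_crossing.
Proof.
exists non_crossing => //; split; first exact: borel_non_crossing.
pose X : {mfun measurableTypeR R >-> Gb} := mfun_Sub (mem_set (@measurable_flow R)).
exists (distribution (uniform_prob (@ltr01 R)) X).
move=> g h; rewrite /distribution /pushforward.
have mN : measurable ((@flow R : measurableTypeR R -> Gb) @^-1` translate g h non_crossing).
  rewrite -[X in measurable X]setTI; apply: measurable_flow => //.
  exact: measurable_translate borel_non_crossing.
have /null_content_dominatesP dom := dominates_uniform_prob (@ltr01 R).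
apply: (dom _ mN).
apply: measure_negligible => //.
by apply: negligibleS (negligible_translates g^-1%g h^-1%g) => t; rewrite translateE.
Qed.

End non_crossing_null.

(** * Random increasing bijections *)

Section random_crossings.
Variables (R : realType) (d : measure_display) (T : measurableType d)
  (P : probability T R).
Implicit Types (kappa : T -> R -> R) (x y e : R).

Lemma small_sets (A : (set T)^nat) e : (forall n, measurable (A n)) ->
  (forall m n, (m <= n)%N -> A n `<=` A m) ->
  (forall w, exists n, ~ A n w) -> 0 < e -> exists n, (P (A n) <= e%:E)%E.
Proof.
move=> mA Am A0 e0.
have P0 : (P \o A) @ \oo --> P (\bigcap_n A n).
  apply: nonincreasing_cvg_mu => //.
  - by rewrite ltey_eq fin_num_measure.
  - exact: bigcapT_measurable.
  - by move=> m n mn; apply/subsetPset/Am.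
have cap0 : \bigcap_n A n = set0.
  by apply/seteqP; split=> // w Aw; have [n] := A0 w; apply; exact: Aw.
rewrite cap0 measure0 in P0.
have /fine_cvgP[_ /cvgrPdist_le/(_ e e0)[n _ Hn]] := P0.
exists n; have /= := Hn n (leqnn n).
rewrite sub0r normrN ger0_norm ?fine_ge0// => h.
by rewrite -[P _]fineK ?lee_fin// fin_num_measure.
Qed.

(** The budget is split geometrically along the codes of the index type, which treats naturals and
    integers alike. *)
Lemma small_union (X : countType) (F : X -> set T) e : 0 <= e ->
  (forall i, measurable (F i)) ->
  (forall i, P (F i) <= (e / (2 ^ (pickle i).+1)%:R)%:E)%E ->
  measurable (\bigcup_i F i) /\ (P (\bigcup_i F i) <= e%:E)%E.
Proof.
move=> e0 mF PF.
pose G n := if (unpickle n : option X) is Some x then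
  (if pickle x == n then F x else set0) else set0.
have mG n : measurable (G n).
  by rewrite /G; case: unpickle => // x; case: ifP.
have -> : \bigcup_i F i = \bigcup_n G n.
  apply/seteqP; split=> w.
    by move=> [x _ Fxw]; exists (pickle x) => //; rewrite /G pickleK eqxx.
  move=> [n _]; rewrite /G; case: unpickle => // x; case: ifP => // _ Fxw.
  by exists x.
have PG n : (P (G n) <= 0 + (e / (2 ^ n.+1)%:R)%:E)%E.
  rewrite add0e /G; case: unpickle => [x|]; last first.
    by rewrite measure0 lee_fin divr_ge0.
  case: eqP => [<-|_]; first exact: PF.
  by rewrite measure0 lee_fin divr_ge0.
split; first exact: bigcupT_measurable.
apply: (@le_trans _ _ (\sum_(n <oo) P (G n))%E).
  by apply: measure_sigma_subadditive => //; exact: bigcupT_measurable.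
apply: (@le_trans _ _ (\sum_(n <oo) (0 + (e / (2 ^ n.+1)%:R)%:E))%E).
  by apply: lee_nneseries => // n _; exact: PG.
apply: le_trans (epsilon_trick xpredT _ e0) _ => //.
by rewrite eseries0// add0e.
Qed.

Definition random_incbij kappa := (forall w, incbij (kappa w)) /\
  (forall x, measurable_fun setT (kappa ^~ x)).

Lemma measurable_set_ge (f : T -> R) c :
  measurable_fun setT f -> measurable [set w | c <= f w].
Proof.
move=> mf; rewrite (_ : [set w | _] = f @^-1` `[c, +oo[%classic).
  by rewrite -[X in measurable X]setTI; exact: mf.
by apply/seteqP; split=> w /=; rewrite in_itv/= andbT.
Qed.

Lemma measurable_set_le (f : T -> R) c :
  measurable_fun setT f -> measurable [set w | f w <= c].
Proof.
move=> mf; rewrite (_ : [set w | _] = f @^-1` `]-oo, c]%classic).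
  by rewrite -[X in measurable X]setTI; exact: mf.
by apply/seteqP; split=> w /=; rewrite in_itv.
Qed.

(** Heights and abscissas alternate: a height that the value at the current abscissa rarely reaches,
    then an abscissa whose value rarely stays below that height. The unit gaps make both sequences
    unbounded. *)
Lemma grid_up kappa (e : nat -> R) : random_incbij kappa ->
  (forall n, 0 < e n) -> exists X Y : nat -> R, [/\ X 0%N = 0, Y 0%N = 0,
    forall n, X n + 1 <= X n.+1 /\ Y n + 1 <= Y n.+1,
    forall n, (P [set w | (Y n.+1 <= kappa w (X n))%R] <= (e n)%:E)%E &
    forall n, (P [set w | (kappa w (X n.+1) <= Y n.+1)%R] <= (e n)%:E)%E].
Proof.
move=> [bk mk] e0.
have /choice[next Hnext] : forall nxy : nat * (R * R), exists xy : R * R,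
    [/\ nxy.2.1 + 1 <= xy.1, nxy.2.2 + 1 <= xy.2,
    (P [set w | (xy.2 <= kappa w nxy.2.1)%R] <= (e nxy.1)%:E)%E &
    (P [set w | (kappa w xy.1 <= xy.2)%R] <= (e nxy.1)%:E)%E].
  move=> [n [x y]] /=.
  have [|m m'|w|k Hk] := @small_sets
      (fun k : nat => [set w | y + 1 + k%:R <= kappa w x]) (e n) _ _ _ (e0 n).
  - by move=> k; exact: measurable_set_ge.
  - by move=> mm' w /=; apply: le_trans; rewrite lerD2l ler_nat.
  - exists (Num.Def.archi_bound `|kappa w x - (y + 1)|) => /=.
    apply/negP; rewrite -ltNge -ltrBlDl; apply: (le_lt_trans (ler_norm _)).
    exact: archi_boundP.
  pose y' := y + 1 + k%:R.
  have [|m m'|w|l Hl] := @small_sets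
      (fun l : nat => [set w | kappa w (x + 1 + l%:R) <= y']) (e n) _ _ _ (e0 n).
  - by move=> l; exact: measurable_set_le.
  - move=> mm' w /=; apply: le_trans.
    by rewrite (incbij_le (bk w)) lerD2l ler_nat.
  - have [z zE] := (bk w).2 y'.
    exists (Num.Def.archi_bound `|z - (x + 1)|) => /=.
    apply/negP; rewrite -ltNge -zE (incbij_lt (bk w)) -ltrBlDl.
    by apply: (le_lt_trans (ler_norm _)); exact: archi_boundP.
  by exists (x + 1 + l%:R, y'); rewrite /= !lerDl !ler0n.
pose st := fix st n : R * R := if n is m.+1 then next (m, st m) else (0, 0).
exists (fun n => (st n).1), (fun n => (st n).2).
by split=> // n; have [? ? ? ?] := Hnext (n, st n).
Qed.

Lemma random_incbij_opp kappa :
  random_incbij kappa -> random_incbij (fun w x => - kappa w (- x)).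
Proof.
move=> [bk mk]; split=> [w|x]; first exact: incbij_opp.
exact: measurable_funN.
Qed.

Lemma grid kappa eps : random_incbij kappa -> 0 < eps ->
  exists a b : int -> R, [/\ bi_unbounded a, bi_unbounded b &
    exists E, [/\ measurable E, (P E <= eps%:E)%E &
      forall w, ~ E w -> forall j, b j < kappa w (a j) < b (j + 1)]].
Proof.
(* The 4 counts the bad events for each [n]: two for the map and two for its reflection. *)
move=> rk eps0; pose e (n : nat) : R := eps / (2 ^ n.+1)%:R / 4.
have e0 n : 0 < e n by rewrite !divr_gt0// ltr0n expn_gt0.
have [X [Y [X0 Y0 HS HY HX]]] := grid_up rk e0.
have [X' [Y' [X'0 Y'0 HS' HY' HX']]] := grid_up (random_incbij_opp rk) e0.
pose a (j : int) := match j with Posz n => X n | Negz n => - X' n.+1 end.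
(* The value at abscissa 0 lies between [- Y' 1] and [Y 1]; on the negative side the heights are
   therefore shifted by one index against the abscissas. *)
pose b (j : int) := match j with
  | Posz 0 => - Y' 1%N | Posz n.+1 => Y n.+1 | Negz n => - Y' n.+2 end.
have aN (n : nat) : a (- n%:Z) = - X' n.
  by case: n => [|n]; rewrite ?oppr0 /a ?X0 ?X'0 ?oppr0.
have bN (n : nat) : b (- n%:Z) = - Y' n.+1 by case: n.
have ge_nat (Z : nat -> R) : Z 0%N = 0 -> (forall n, Z n + 1 <= Z n.+1) ->
    forall n, n%:R <= Z n.
  move=> Z0 ZS; elim=> [|n IH]; first by rewrite Z0.
  by apply: le_trans (ZS n); rewrite -natr1 lerD2r.
have Xn := ge_nat X X0 (fun n => (HS n).1).
have Yn := ge_nat Y Y0 (fun n => (HS n).2).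
have X'n := ge_nat X' X'0 (fun n => (HS' n).1).
have Y'n := ge_nat Y' Y'0 (fun n => (HS' n).2).
have above y : exists n : nat, y <= n%:R.
  exists (Num.Def.archi_bound `|y|); apply: (le_trans (ler_norm _)).
  exact/ltW/archi_boundP.
exists a, b; split.
- split=> [j|y|y].
  + case: j => n; first by rewrite -PoszD addn1 /=; have := (HS n).1; lra.
    have -> : Negz n + 1 = - n%:Z by lia.
    by rewrite aN /=; have := (HS' n).1; lra.
  + have [n yn] := above (- y); exists (- n%:Z); rewrite aN.
    by have := X'n n; lra.
  + by have [n yn] := above y; exists n%:Z; exact: le_trans (Xn n).
- split=> [j|y|y].
  + case: j => [[|n]|n].
    * by rewrite add0r /=; have := (HS 0%N).2; have := (HS' 0%N).2; lra.
    * by rewrite -PoszD addn1 /=; have := (HS n.+1).2; lra.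
    have -> : Negz n + 1 = - n%:Z by lia.
    by rewrite bN /=; have := (HS' n.+1).2; lra.
  + have [n yn] := above (- y); exists (- n%:Z); rewrite bN.
    have := Y'n n.+1; have : n%:R <= n.+1%:R :> R by rewrite ler_nat.
    by lra.
  + have [n yn] := above y; exists n.+1%:Z.
    apply: (le_trans yn); apply: le_trans (Yn n.+1).
    by rewrite ler_nat.
have [bk mk] := rk.
pose F n := ([set w | Y n.+1 <= kappa w (X n)] `|`
             [set w | kappa w (X n.+1) <= Y n.+1]) `|`
  ([set w | Y' n.+1 <= - kappa w (- X' n)] `|`
   [set w | - kappa w (- X' n.+1) <= Y' n.+1]).
have m1 n := measurable_set_ge (Y n.+1) (mk (X n)).
have m2 n := measurable_set_le (Y n.+1) (mk (X n.+1)).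
have m3 n := measurable_set_ge (Y' n.+1) (measurable_funN (mk (- X' n))).
have m4 n := measurable_set_le (Y' n.+1) (measurable_funN (mk (- X' n.+1))).
have mF n : measurable (F n).
  exact: (measurableU _ _ (measurableU _ _ (m1 n) (m2 n)) (measurableU _ _ (m3 n) (m4 n))).
have [|mE PE] := @small_union nat F eps (ltW eps0) mF.
  move=> n; have -> : eps / (2 ^ (pickle n).+1)%:R = (e n + e n) + (e n + e n).
    by rewrite /e; change (pickle n) with n; field; rewrite pnatr_eq0 expn_eq0.
  rewrite !EFinD.
  apply: le_trans (measureU2 P (measurableU _ _ (m1 n) (m2 n))
    (measurableU _ _ (m3 n) (m4 n))) _; apply: leeD.
    by apply: le_trans (measureU2 P (m1 n) (m2 n)) _; apply: leeD; [exact: HY|exact: HX].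
  by apply: le_trans (measureU2 P (m3 n) (m4 n)) _; apply: leeD; [exact: HY'|exact: HX'].
exists (\bigcup_n F n); split=> // w nF j.
have nFn n : [/\ kappa w (X n) < Y n.+1, Y n.+1 < kappa w (X n.+1),
    - kappa w (- X' n) < Y' n.+1 & Y' n.+1 < - kappa w (- X' n.+1)].
  have /not_orP[/not_orP[h1 h2] /not_orP[h3 h4]] : ~ F n w.
    by move=> Fn; apply: nF; exists n.
  by split; rewrite ltNge; apply/negP.
case: j => [[|n]|n].
- rewrite add0r /= X0; have [h1 _ h3 _] := nFn 0%N.
  by move: h1 h3; rewrite X0 X'0 oppr0 => h1 h3; rewrite h1 ltrNl h3.
- rewrite -PoszD addn1 /=; have [_ h2 _ _] := nFn n; have [h1 _ _ _] := nFn n.+1.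
  by rewrite h2 h1.
- have -> : Negz n + 1 = - n%:Z by lia.
  rewrite bN /=; have [_ _ _ h4] := nFn n; have [_ _ h3 _] := nFn n.+1.
  by rewrite ltrNl h3 ltrNr h4.
Qed.

End random_crossings.

(** * Normalization and the comparison curve *)

Section random_type.
Variables (R : realType) (d : measure_display) (T : measurableType d)
  (P : probability T R).
Implicit Types (kappa : T -> R -> R) (x y z e : R).

(** Moving the grid to the integers puts the value at an integer [j] between [j] and [j + 1];
    monotonicity loses at most one more unit on either side. *)
Lemma normalize kappa eps : random_incbij kappa -> 0 < eps ->
  exists p q : R -> R, [/\ incbij p, incbij q &
    exists E, [/\ measurable E, (P E <= eps%:E)%E &
      forall w, ~ E w -> forall x, x - 1 < q (kappa w (p x)) < x + 2]].
Proof.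
move=> rk eps0; have [a [b [ua ub [E [mE PE HE]]]]] := grid P rk eps0.
have [p [bp pE]] := interpolate ua; have [q' [bq' q'E]] := interpolate ub.
have [q [bq q'K qK]] := incbij_inv bq'.
exists p, q; split=> //; exists E; split=> // w nEw x.
have Hj (j : int) : j%:~R < q (kappa w (p j%:~R)) < (j + 1)%:~R.
  have /andP[h1 h2] := HE w nEw j.
  by apply/andP; split; rewrite -(incbij_lt bq') qK pE q'E.
have bk : incbij (fun x => q (kappa w (p x))).
  exact: incbij_comp (incbij_comp bq (rk.1 w)) bp.
have /andP[l1 l2] := floor_itv x; set j := Num.floor x in l1 l2.
have /andP[h1 _] := Hj j; have /andP[_ h2] := Hj (j + 1).
rewrite !intrD in l2 h2; apply/andP; split.
  apply: (@lt_le_trans _ _ (q (kappa w (p j%:~R)))); first by lra.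
  by rewrite (incbij_le bk).
apply: (@le_lt_trans _ _ (q (kappa w (p (j + 1)%:~R)))).
  by rewrite (incbij_le bk) intrD ltW.
by rewrite intrD; lra.
Qed.

Definition clamp lo hi x : R := Num.max lo (Num.min x hi).

Lemma clamp_homo lo hi : {homo clamp lo hi : x y / x <= y}.
Proof.
by move=> x y xy; rewrite /clamp ge_max !le_max lexx /= le_min !ge_min lexx xy !orbT.
Qed.

Lemma clamp_id lo hi x : lo <= x <= hi -> clamp lo hi x = x.
Proof. by move=> /andP[lx xh]; rewrite /clamp min_l// max_r. Qed.

Lemma clamp_lo lo hi x : x <= lo -> clamp lo hi x = lo.
Proof. by move=> xl; rewrite /clamp max_l// ge_min xl. Qed.

Lemma clamp_hi lo hi x : lo <= hi -> hi <= x -> clamp lo hi x = hi.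
Proof. by move=> lh hx; rewrite /clamp min_r// max_r. Qed.

Lemma measurable_clamp lo hi (f : T -> R) :
  measurable_fun setT f -> measurable_fun setT (fun w => clamp lo hi (f w)).
Proof.
by move=> mf; apply: measurable_maxr => //; exact: measurable_minr.
Qed.

Section window.
Variables (kappa : T -> R -> R) (D : set T).
Hypotheses (rk : random_incbij kappa) (mD : measurable D)
  (HD : forall w, D w -> forall x, x - 1 < kappa w x < x + 2).

(* On the window [c0, c0 + 10] an affine function crosses almost all of the
   [kappa w] at most once if it is flat enough or steep enough and its offset is
   well chosen. *)
Lemma flat_window c0 e : 0 < e -> exists l, [/\ incbij l,
  c0 + 3 <= l c0, l (c0 + 10) <= c0 + 8 & exists E, [/\ measurable E,
    (P E <= e%:E)%E & forall w, D w -> ~ E w -> forall x y,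
      c0 <= x <= c0 + 10 -> c0 <= y <= c0 + 10 ->
      kappa w x = l x -> kappa w y = l y -> x = y]].
Proof.
(* The good level costs [2 * eta = 44 * dl] in probability; the bound 1/20 keeps the line within its
   end heights. *)
move=> e0; pose dl := Num.min (20^-1) (e / 44).
have d0 : 0 < dl by rewrite lt_min invr_gt0 divr_gt0 ?ltr0n.
have d1 : dl <= 20^-1 by rewrite ge_min lexx.
have d2 : dl <= e / 44 by rewrite ge_min lexx orbT.
(* Clamping [kappa] to the heights that the lines can take removes the irrelevant variation: the
   difference [u - v] goes from 0 to 1, and the total variation is [1 + 22 * dl]. *)
pose hi := c0 + 6 + 11 * dl.
pose u w x := clamp (c0 + 5) hi (kappa w x).
pose v (w : T) x := c0 + 5 + dl * (x - c0).
(* The interval exceeds the window by one unit because a good level excludes a second crossing only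
   on a half-open interval. *)
have [|||x|w x y xy|w x y xy|w Dw|c c01 [E [mE PE HE]]] :=
    @exists_good_level R d T P D u v c0 (c0 + 11) (22 * dl) mD.
- by lra.
- by rewrite mulr_gt0.
- by move=> x; apply: measurable_clamp; exact: rk.2.
- exact: measurable_cst.
- by apply: clamp_homo; rewrite (incbij_le (rk.1 w)).
- by rewrite lerD2l ler_wpM2l ?(ltW d0)// lerB.
- have /andP[p1 p2] := HD Dw c0; have /andP[q1 q2] := HD Dw (c0 + 11).
  rewrite /u /v clamp_lo; last by lra.
  by rewrite clamp_hi /hi; [split; lra|lra|lra].
exists (fun x => c0 + 5 + c + dl * (x - c0)); split.
- split=> [x y xy|y]; first by rewrite ltrD2l ltr_pM2l// ltrD2r.
  exists ((y - c0 - 5 - c) / dl + c0); rewrite addrK mulrC divfK ?gt_eqF//.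
  by ring.
- by lra.
- by lra.
exists E; split=> //; first by apply: (le_trans PE); rewrite lee_fin; lra.
move=> w Dw nEw x y /andP[x1 x2] /andP[y1 y2] kx ky.
have uv z : c0 <= z -> z <= c0 + 10 -> kappa w z = c0 + 5 + c + dl * (z - c0) ->
    u w z - v w z = c.
  move=> z1 z2 kz; rewrite /u clamp_id kz; first by rewrite /v; ring.
  by rewrite /hi; apply/andP; split; nra.
apply: (HE w Dw nEw) => //; [lra|lra|exact: uv|exact: uv].
Qed.

(** The roles are exchanged: [kappa w x = l x] is solved for [x], as [x = c0 + 5 + c + dl * (kappa w
    x - c0 - 5)]. The identity is clamped, and [kappa] scaled by [dl] varies slowly. *)
Lemma steep_window c0 e : 0 < e -> exists l, [/\ incbij l,
  l c0 <= c0 - 2, c0 + 13 <= l (c0 + 10) & exists E, [/\ measurable E,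
    (P E <= e%:E)%E & forall w, D w -> ~ E w -> forall x y,
      c0 <= x <= c0 + 10 -> c0 <= y <= c0 + 10 ->
      kappa w x = l x -> kappa w y = l y -> x = y]].
Proof.
move=> e0; pose dl := Num.min (20^-1) (e / 60).
have d0 : 0 < dl by rewrite lt_min invr_gt0 divr_gt0 ?ltr0n.
have d1 : dl <= 20^-1 by rewrite ge_min lexx.
have d2 : dl <= e / 60 by rewrite ge_min lexx orbT.
(* Over the interval [kappa w x - c0 - 5] lies between -6 and 8, so a slack of [8 * dl] suffices at
   both ends. The variations are at most [14 * dl] for [v] and [1 + 16 * dl] for [u]. *)
pose lo := c0 + 5 - 8 * dl; pose hi := c0 + 6 + 8 * dl.
pose u (w : T) x := clamp lo hi x.
pose v w x := c0 + 5 + dl * (kappa w x - c0 - 5).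
have [|||x|w x y xy|w x y xy|w Dw|c c01 [E [mE PE HE]]] :=
    @exists_good_level R d T P D u v c0 (c0 + 11) (30 * dl) mD.
- by lra.
- by rewrite mulr_gt0.
- by move=> x; exact: measurable_cst.
- apply: measurable_funD => //; apply: measurable_funM => //.
  by apply: measurable_funB => //; apply: measurable_funB => //; exact: rk.2.
- exact: clamp_homo.
- by rewrite lerD2l ler_wpM2l ?(ltW d0)// !lerB// (incbij_le (rk.1 w)).
- have /andP[p1 p2] := HD Dw c0; have /andP[q1 q2] := HD Dw (c0 + 11).
  rewrite /u clamp_lo; last by rewrite /lo; lra.
  rewrite clamp_hi /hi ?/lo; [|lra|lra].
  by rewrite /v; split; nra.
exists (fun x => c0 + 5 + (x - c0 - 5 - c) / dl); split.
- split=> [x y xy|y].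
    by rewrite ltrD2l ltr_pM2r ?invr_gt0// !ltrD2r.
  exists ((y - c0 - 5) * dl + c0 + 5 + c).
  by field; rewrite gt_eqF.
- rewrite -lerBrDl ler_pdivrMr//; nra.
- rewrite -lerBlDl ler_pdivlMr//; nra.
exists E; split=> //; first by apply: (le_trans PE); rewrite lee_fin; lra.
move=> w Dw nEw x y /andP[x1 x2] /andP[y1 y2] kx ky.
have uv z : c0 <= z -> z <= c0 + 10 ->
    kappa w z = c0 + 5 + (z - c0 - 5 - c) / dl -> u w z - v w z = c.
  move=> z1 z2 kz; have /andP[h1 h2] := HD Dw z.
  have zE : z = c0 + 5 + c + dl * (kappa w z - c0 - 5).
    by rewrite kz; field; rewrite gt_eqF.
  rewrite /u clamp_id; first by rewrite /v {1}zE; ring.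
  by rewrite /lo /hi; apply/andP; split; nra.
apply: (HE w Dw nEw) => //; [lra|lra|exact: uv|exact: uv].
Qed.

(** For equal signs a translate of the identity avoids the strip altogether; a change of sign calls
    for a steep or a flat traversal. *)
Lemma window (s0 s1 : bool) c0 e : 0 < e -> exists l, [/\ incbij l,
  (if s0 then l c0 <= c0 - 2 else c0 + 3 <= l c0),
  (if s1 then l (c0 + 10) <= c0 + 10 - 2 else c0 + 10 + 3 <= l (c0 + 10)) &
  exists E, [/\ measurable E, (P E <= e%:E)%E &
    forall w, D w -> ~ E w -> (forall x y,
      c0 <= x <= c0 + 10 -> c0 <= y <= c0 + 10 ->
      kappa w x = l x -> kappa w y = l y -> x = y) /\
    (s0 = s1 -> forall x, kappa w x <> l x)]].
Proof.
move=> e0; case: s0; case: s1.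
- exists (fun x => x - 2); split; [exact: translation_subproof|lra|lra|].
  exists set0; split=> //; first by rewrite measure0 lee_fin ltW.
  have no w x : D w -> kappa w x <> x - 2 by move=> /HD/(_ x)/andP[? ?] ?; lra.
  by move=> w Dw _; split=> [x y _ _ /(no _ _ Dw)//|_ x]; exact: no.
- have [l [bl l0 l1 [E [mE PE HE]]]] := steep_window c0 e0.
  exists l; split=> //; first lra.
  by exists E; split=> // w Dw nEw; split=> //; exact: HE.
- have [l [bl l0 l1 [E [mE PE HE]]]] := flat_window c0 e0.
  exists l; split=> //; first lra.
  by exists E; split=> // w Dw nEw; split=> //; exact: HE.
- exists (fun x => x + 3); split; [exact: translation_subproof|lra|lra|].
  exists set0; split=> //; first by rewrite measure0 lee_fin ltW.
  have no w x : D w -> kappa w x <> x + 3 by move=> /HD/(_ x)/andP[? ?] ?; lra.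
  by move=> w Dw _; split=> [x y _ _ /(no _ _ Dw)//|_ x]; exact: no.
Qed.

End window.

Lemma incbij_max (f g : R -> R) :
  incbij f -> incbij g -> incbij (fun x => Num.max (f x) (g x)).
Proof.
move=> bf bg; split=> [x y xy|y].
  by rewrite gt_max !lt_max bf.1// bg.1// orbT.
have [a fa] := bf.2 y; have [b gb] := bg.2 y.
have [ab|/ltW ba] := leP a b.
  by exists a; rewrite fa max_l// -gb (incbij_le bg).
by exists b; rewrite gb max_r// -fa (incbij_le bf).
Qed.

Lemma incbij_min (f g : R -> R) :
  incbij f -> incbij g -> incbij (fun x => Num.min (f x) (g x)).
Proof.
move=> bf bg; split=> [x y xy|y].
  by rewrite lt_min !gt_min bf.1// bg.1// orbT.
have [a fa] := bf.2 y; have [b gb] := bg.2 y.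
have [ab|/ltW ba] := leP a b.
  by exists b; rewrite gb min_r// -fa (incbij_le bf).
by exists a; rewrite fa min_l// -gb (incbij_le bg).
Qed.

(** The median of [x - 2], [l x] and [x + 3]. Truncating outside the strip creates no crossing and
    lets the pieces of neighbouring windows agree at their common end. *)
Definition med l x : R := Num.max (x - 2) (Num.min (x + 3) (l x)).

Lemma incbij_med l : incbij l -> incbij (med l).
Proof.
move=> bl; apply: incbij_max; first exact: translation_subproof.
by apply: incbij_min => //; exact: translation_subproof.
Qed.

Lemma med_low l x : l x <= x - 2 -> med l x = x - 2.
Proof. by move=> lx; rewrite /med max_l// ge_min lx orbT. Qed.

Lemma med_high l x : x + 3 <= l x -> med l x = x + 3.
Proof. by move=> lx; rewrite /med min_l// max_r//; lra. Qed.

Lemma med_eq l x y : x - 1 < y < x + 2 -> y = med l x -> y = l x.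
Proof.
move=> /andP[y1 y2] ye; move: y1 y2; rewrite {}ye /med.
case: (leP (x + 3) (l x)) => h; first by rewrite max_r; lra.
by case: (leP (x - 2) (l x)) => h'; lra.
Qed.

(* [true] in [s] means that [kappa w] is above the curve, which follows
   [x - 2] there, and [false] that it is below, where the curve follows
   [x + 3]. *)
Lemma exists_curve kappa (D : set T) (s : int -> bool) eps :
  random_incbij kappa -> measurable D -> 0 < eps ->
  (forall w, D w -> forall x, x - 1 < kappa w x < x + 2) ->
  exists h, incbij h /\ exists E, [/\ measurable E, (P E <= eps%:E)%E &
    forall w, D w -> ~ E w -> forall i : int,
    [/\ kappa w (10 * i%:~R) != h (10 * i%:~R),
     (h (10 * i%:~R) < kappa w (10 * i%:~R)) = s i,
     forall x y, 10 * i%:~R <= x <= 10 * (i + 1)%:~R ->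
       10 * i%:~R <= y <= 10 * (i + 1)%:~R ->
       kappa w x = h x -> kappa w y = h y -> x = y &
     s i = s (i + 1) -> forall x, 10 * i%:~R <= x <= 10 * (i + 1)%:~R ->
       kappa w x <> h x]].
Proof.
move=> rk mD eps0 HD.
pose e (i : int) : R := eps / (2 ^ (pickle i).+1)%:R.
have e0 i : 0 < e i by rewrite divr_gt0// ltr0n expn_gt0.
have /choice[l Hl] : forall i : int, _ :=
  fun i => window rk mD HD (s i) (s (i + 1)) (10 * i%:~R) (e0 i).
have /choice[E HE] : forall i : int, exists E, _ :=
  fun i => let: And4 _ _ _ H := Hl i in H.
pose h x := med (l (Num.floor (x / 10))) x.
have tS (i : int) : 10 * i%:~R + 10 = 10 * (i + 1)%:~R :> R by rewrite intrD; ring.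
have hE (i : int) x : 10 * i%:~R <= x <= 10 * (i + 1)%:~R -> h x = med (l i) x.
  move=> /andP[ix]; rewrite le_eqVlt => /orP[/eqP ->|xi].
    rewrite /h mulrC mulKf ?pnatr_eq0// intrKfloor.
    (* Both windows impose the sign [s (i + 1)] at this node, so both pieces are truncated to the
       same bound. *)
    have [_ + _ _] := Hl (i + 1); have [_ _ + _] := Hl i; rewrite tS.
    by case: (s (i + 1)) => h1 h2; [rewrite !med_low|rewrite !med_high].
  rewrite /h (floor_def (m := i))// ler_pdivlMr// ltr_pdivrMr//.
  by rewrite ![_ * 10]mulrC ix xi.
have hi (i : int) : h (10 * i%:~R) = 10 * i%:~R + (if s i then - 2 else 3).
  have [_ + _ _] := Hl i; rewrite (hE i); last by rewrite lexx -tS lerDl ler0n.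
  by case: (s i) => h1; [rewrite med_low|rewrite med_high].
have bmed i : incbij (med (l i)) by apply: incbij_med; have [] := Hl i.
have sE (b : bool) : -2 <= (if b then - 2 else 3 : R) <= 3.
  by case: b; apply/andP; split; lra.
have bh : incbij h.
  have bg : incbij (fun x => h (10 * x)).
    apply: glue_incbij => [i x y ix xy yi|i y iy yi|y|y].
    - have r10 z : (i%:~R <= z) && (z <= (i + 1)%:~R) ->
          10 * i%:~R <= 10 * z <= 10 * (i + 1)%:~R.
        by rewrite !ler_pM2l.
      rewrite (hE i) ?(hE i (10 * y)) ?r10 ?ix ?yi
        ?(le_trans ix (ltW xy)) ?(le_trans (ltW xy) yi)//.
      by rewrite (incbij_lt (bmed i)) ltr_pM2l.
    - move: iy yi; rewrite !(hE i) ?lexx ?ler_pM2l ?ler_int ?lerDl ?andbT// => iy yi.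
      have [x xE] := (bmed i).2 y; exists (x / 10).
      have x10 : 10 * (x / 10) = x by rewrite mulrC divfK// pnatr_eq0.
      rewrite x10 (hE i) ?xE//.
      by apply/andP; split; rewrite -(incbij_le (bmed i)) xE.
    - exists (Num.floor ((y - 3) / 10)); rewrite hi.
      have := floor_le ((y - 3) / 10); have /andP[_ h2] := sE (s (Num.floor ((y - 3) / 10))).
      by move: (_%:~R) (if _ then _ else _) h2 => z t h2; lra.
    - exists (Num.floor ((y + 2) / 10) + 1); rewrite hi.
      have := floorD1_gt ((y + 2) / 10); have /andP[h1 _] := sE (s (Num.floor ((y + 2) / 10) + 1)).
      by move: (_%:~R) (if _ then _ else _) h1 => z t h1; lra.
  have b10 : incbij (fun x : R => x / 10).
    split=> [x y xy|y]; first by rewrite ltr_pM2r ?invr_gt0.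
    by exists (10 * y); rewrite mulrC mulKf// pnatr_eq0.
  have := incbij_comp bg b10; congr incbij; apply/funext => x /=.
  by rewrite mulrC divfK// pnatr_eq0.
exists h; split=> //; exists (\bigcup_i E i).
have [//||mE PE] := @small_union R d T P int E eps (ltW eps0).
- by move=> i; have [] := HE i.
- by move=> i; have [] := HE i.
split=> // w Dw nEw i.
have nEiw : ~ E i w by move=> Eiw; apply: nEw; exists i.
have [_ _ /(_ w Dw nEiw)[uniq none]] := HE i; rewrite tS in uniq.
have kl x : 10 * i%:~R <= x <= 10 * (i + 1)%:~R -> kappa w x = h x ->
    kappa w x = l i x.
  by move=> xi; rewrite (hE i)//; apply: med_eq; exact: HD.
have /andP[k1 k2] := HD w Dw (10 * i%:~R).
split.
- by rewrite hi; case: (s i); apply/eqP; lra.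
- rewrite hi; case: (s i); first by lra.
  by apply/negbTE; rewrite -leNgt; lra.
- by move=> x y xi yi /(kl x xi) kx /(kl y yi) ky; exact: uniq.
- by move=> si x xi /(kl x xi); exact: none.
Qed.

(** The inverse of the curve straightens it to the diagonal, so that crossings become fixed points.
    Normalization and curve spend probability 1/4 each. *)
Lemma exists_random_type kappa (s : int -> bool) : random_incbij kappa ->
  exists p q : R -> R, [/\ incbij p, incbij q &
    exists E, [/\ measurable E, (P E <= 2^-1%:E)%E &
      forall w, ~ E w -> has_type s (fun x => q (kappa w (p x)))]].
Proof.
move=> rk; have e4 : 0 < 4^-1 :> R by rewrite invr_gt0.
have [p [q [bp bq [E0 [mE0 PE0 HE0]]]]] := normalize rk e4.
pose k w x := q (kappa w (p x)).
have bk w : incbij (k w).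
  exact: incbij_comp (incbij_comp bq (rk.1 w)) bp.
have rk' : random_incbij k.
  split=> // x; apply: (measurableT_comp (f := q)); last exact: rk.2.
  by apply: continuous_measurable_fun; exact: incbij_continuous.
have [h [bh [E1 [mE1 PE1 HE1]]]] := exists_curve s rk' (measurableC mE0) e4 HE0.
have [h' [bh' hK h'K]] := incbij_inv bh.
exists p, (h' \o q); split=> //; first exact: incbij_comp bh' bq.
exists (E0 `|` E1); split; first exact: measurableU.
  apply: (le_trans (measureU2 P mE0 mE1)); apply: (le_trans (leeD PE0 PE1)).
  by rewrite -EFinD lee_fin; lra.
move=> w /not_orP[nE0 nE1].
have eqE x : ((h' \o q) (kappa w (p x)) == x) = (k w x == h x).
  by rewrite -(inj_eq (incbij_inj bh)) /= h'K.
have ltE x : (x < (h' \o q) (kappa w (p x))) = (h x < k w x).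
  by rewrite -(incbij_lt bh) /= h'K.
apply: (@has_type_of_samples R s _ (fun i => 10 * i%:~R)).
- exact: incbij_comp bh' (bk w).
- split=> [i|y|y]; first by rewrite ltr_pM2l// ltr_int ltrDl.
    exists (Num.floor (y / 10)); have := floor_le (y / 10).
    by move: (_%:~R) => z; lra.
  exists (Num.floor (y / 10) + 1); have := floorD1_gt (y / 10).
  by move: (_%:~R) => z; lra.
- move=> i; have [h1 h2 h3 h4] := HE1 w nE0 nE1 i.
  split; first by rewrite eqE.
  + by rewrite ltE.
  + by move=> x y xi yi /eqP; rewrite eqE => /eqP kx /eqP; rewrite eqE => /eqP ky; exact: h3.
  + by move=> si x xi /eqP; rewrite eqE => /eqP; exact: h4.
Qed.

End random_type.

(** * The characterization *)

Section characterization.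
Variable R : realType.
Local Notation I := (unit_interval R).
Local Notation Gb := (g_sigma_algebraType (@open (homeo R))).
Implicit Types (f g h k b : homeo R) (x y z e : R) (u w : I).

Lemma incbij_ball (c : R -> R) z e : incbij c -> 0 < e ->
  exists2 d, 0 < d & forall y, `|y - c z| < d -> exists2 x, c x = y & `|x - z| < e.
Proof.
move=> bc e0; exists (Num.min (c z - c (z - e)) (c (z + e) - c z)).
  by rewrite lt_min !subr_gt0 !(incbij_lt bc) ltrBlDr !ltrDl e0.
move=> y; rewrite lt_min !ltr_distl => /andP[/andP[y1 _] /andP[_ y2]].
have [x xE] := bc.2 y; exists x => //.
rewrite subKr -xE (incbij_lt bc) in y1; rewrite subrKC -xE (incbij_lt bc) in y2.
by rewrite ltr_distl y1 y2.
Qed.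

Lemma conjugate_has_limit_fix (F G : R -> R) : incbij G ->
  conjugate F G -> has_limit_fix G -> has_limit_fix F.
Proof.
move=> bG [c [bc cF]] [z Hz]; have [z' zE] := bc.2 z; exists z' => e e0.
have [d d0 Hd] := incbij_ball z' bc e0.
have [y [yz yd Gy]] := Hz d d0; rewrite -zE in yz yd.
have [x xE xe] := Hd y yd; exists x; split=> //.
- by apply: contraNneq yz => <-; rewrite xE.
- by apply: (incbij_inj bc); rewrite cF xE.
Qed.

Lemma conjugate_touches (F G : R -> R) : incbij G ->
  conjugate F G -> touches F -> touches G.
Proof.
move=> bG [c [bc cF]] [z [Fz [e e0 He]]]; exists (c z); split; first by rewrite -cF Fz.
have [d d0 Hd] := incbij_ball z bc e0; exists d => //.
case: He => He; [left|right] => y /Hd[x <- /He]; by rewrite -cF (incbij_le bc).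
Qed.

(** The measure witnessing nullness of a Borel set around the class serves as the law of k. With
    probability at least 1/2 the map q k p is conjugate to [f], so some translate of the Borel set
    has positive measure. *)
Lemma not_haar_null_conj_class f : ~ has_limit_fix (hat f) ->
  ~ touches (hat f) -> ~ haar_null R (conj_class f).
Proof.
move=> nl nt [B [mB [mu Hmu]] CB].
have [s fs] := crossing_has_type (hat_incbij f) nl nt.
have rh : random_incbij (fun k : Gb => hat k).
  by split=> [k|x]; [exact: hat_incbij|exact: measurable_hat].
have [p [q [bp bq [E [mE muE HE]]]]] := exists_random_type mu s rh.
have [p' p'E] := homeo_of_incbij bp; have [q' q'E] := homeo_of_incbij bq.
have EB : ~` E `<=` translate q'^-1%g p'^-1%g B.
  move=> k /HE ks; rewrite translateE /= !invgK; apply: CB.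
  apply: conjugate_conj_class.
  apply: (has_type_conjugate (hat_incbij f) (hat_incbij _) fs).
  rewrite (_ : hat _ = (fun x => q (hat k (p x))))//.
  by apply/funext => x; rewrite !hat_mul p'E q'E.
have mt := measurable_translate q'^-1%g p'^-1%g mB.
have : (mu (~` E) <= 0)%E.
  by rewrite -(Hmu q'^-1%g p'^-1%g); apply: le_measure; rewrite ?inE//; exact: measurableC.
rewrite probability_setC// leNgt => /negP; apply.
rewrite -(@fineK _ (mu E)) ?fin_num_measure// -EFinB lte_fin subr_gt0.
rewrite -lte_fin fineK ?fin_num_measure//; apply: (le_lt_trans muE).
by rewrite lte_fin invf_lt1// ltr1n.
Qed.

Lemma nbhs_toI z (A : set I) : nbhs (toI z) A <->
  exists2 e, 0 < e & forall x, `|x - z| < e -> A (toI x).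
Proof.
split=> [/nbhs_unit_interval[e e0 HA]|[e e0 HA]].
  exists e => // x xz; apply: HA => /=; apply: le_lt_trans xz.
  have lip s t : s <= t -> `|sigm s - sigm t| <= `|s - t|.
    move=> st; rewrite distrC (distrC s) !ger0_norm ?subr_ge0// ?sigm_lipschitz//.
    by rewrite leNgt sigm_lt -leNgt.
  by have [xz|/ltW xz] := leP x z; [|rewrite distrC (distrC x)]; exact: lip.
apply/nbhs_unit_interval.
exists (Num.min (sigm z - sigm (z - e)) (sigm (z + e) - sigm z)).
  by rewrite lt_min !subr_gt0 !sigm_lt ltrBlDr !ltrDl e0.
move=> w; rewrite lt_min !ltr_distl /= subKr subrKC => /andP[/andP[w1 _] /andP[_ w2]].
have w01 : 0 < val w < 1.
  have /andP[s0 _] := sigm_itv (z - e); have /andP[_ s1] := sigm_itv (z + e).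
  by rewrite (lt_trans s0 w1) (lt_trans w2 s1).
rewrite -(toIK w01); apply: HA.
by rewrite -(logitK w01) !sigm_lt in w1 w2; rewrite ltr_distl w1 w2.
Qed.

Lemma Fix_toI f x : Fix f (toI x) <-> hat f x = x.
Proof.
rewrite /Fix /= -toI_hat; split=> [|->//]; exact: toI_inj.
Qed.

(** Only interior points appear in the chart; accumulation at 0 or 1 becomes accumulation at
    infinity, which [has_limit_fix] does not see. *)
Lemma limit_point_Fix f :
  (exists u, 0 < val u < 1 /\ limit_point (Fix f) u) <-> has_limit_fix (hat f).
Proof.
split=> [[u [u01 lu]]|[z Hz]].
  rewrite -(toIK u01) in lu; exists (logit (val u)) => e e0.
  have [|w [wu fw [x xe xw]]] := lu [set w | exists2 x, `|x - logit (val u)| < e & toI x = w].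
    by apply/nbhs_toI; exists e => // x xe; exists x.
  exists x; split=> //; last by apply/Fix_toI; rewrite xw.
  by apply: contraNneq wu => <-; rewrite xw.
exists (toI z); split; first exact: sigm_itv.
move=> A /nbhs_toI[e e0 HA]; have [x [xz xe fx]] := Hz e e0.
exists (toI x); split; [|exact/Fix_toI|exact: HA].
by rewrite (inj_eq (@toI_inj R)).
Qed.

Lemma local_extremum_toI f z : hat f z = z ->
  local_extremum (fun u : I => val (f u) - val u) (toI z) <->
  exists2 e, 0 < e & (forall x, `|x - z| < e -> x <= hat f x) \/
                     (forall x, `|x - z| < e -> hat f x <= x).
Proof.
move=> fz; rewrite /local_extremum -toI_hat fz subrr.
have leE x : (val (f (toI x)) - val (toI x) <= 0) = (hat f x <= x).
  by rewrite -toI_hat subr_le0 /= leNgt sigm_lt -leNgt.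
have geE x : (0 <= val (f (toI x)) - val (toI x)) = (x <= hat f x).
  by rewrite -toI_hat subr_ge0 /= leNgt sigm_lt -leNgt.
split=> [[/nbhs_toI[e e0 H]|/nbhs_toI[e e0 H]]|[e e0 [H|H]]].
- by exists e => //; right => x /H; rewrite /= leE.
- by exists e => //; left => x /H; rewrite /= geE.
- by right; apply/nbhs_toI; exists e => // x /H; rewrite /= geE.
- by left; apply/nbhs_toI; exists e => // x /H; rewrite /= leE.
Qed.

Lemma crossingP f :
  (forall u, 0 < val u < 1 -> ~ limit_point (Fix f) u) /\
  (forall u, Fix f u -> 0 < val u < 1 ->
     ~ local_extremum (fun u : I => val (f u) - val u) u) <->
  ~ has_limit_fix (hat f) /\ ~ touches (hat f).
Proof.
split=> [[nl ne]|[nl nt]]; split.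
- by move=> /limit_point_Fix[u [u01]]; exact: nl.
- move=> [z [fz He]]; apply: (ne (toI z)); [exact/Fix_toI|exact: sigm_itv|].
  exact/local_extremum_toI.
- by move=> u u01 lu; apply: nl; apply/limit_point_Fix; exists u.
- move=> u + u01; rewrite -(toIK u01); set z := logit _ => /Fix_toI fz.
  by move=> /local_extremum_toI => /(_ fz) He; apply: nt; exists z.
Qed.

Lemma haar_nullS (A B : set (homeo R)) :
  A `<=` B -> haar_null R B -> haar_null R A.
Proof. by move=> AB [C nC BC]; exists C => //; exact: subset_trans BC. Qed.

Lemma conj_class_refl f : conj_class f f.
Proof. by exists 1%g => //; rewrite mul1g invg1 mulg1. Qed.

End characterization.

Theorem theorem3p2 (R : realType) :
  (forall f : homeo R,
     ~ haar_null R (conj_class f) <->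
     (forall x : unit_interval R,
        0 < val x < 1 -> ~ limit_point (Fix f) x) /\
     (forall x0 : unit_interval R,
        Fix f x0 -> 0 < val x0 < 1 ->
        ~ local_extremum (fun x : unit_interval R => val (f x) - val x) x0)) /\
  co_haar_null R
    (\bigcup_(C in [set C : set (homeo R) |
        (exists f : homeo R, C = conj_class f) /\ ~ haar_null R C]) C).
Proof.
split=> [f|].
  split=> [nf|/crossingP[nl nt]]; last exact: not_haar_null_conj_class.
  (* Both defects are conjugacy invariant, so the whole class of a map with one of them lies in the
     null set. *)
  apply/crossingP/not_orP => bad; apply: nf.
  apply: haar_nullS (haar_null_non_crossing R) => g /conj_class_conjugate fg.
  apply: non_crossing_hat; case: bad => [fl|ft]; [left|right].
    exact: conjugate_has_limit_fix (hat_incbij f) (conjugate_sym fg) fl.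
  exact: conjugate_touches (hat_incbij g) fg ft.
(* A map outside the union has a defect; otherwise its own class would be among those united. *)
apply: haar_nullS (haar_null_non_crossing R) => f nf.
apply: non_crossing_hat; apply: contrapT => /not_orP[nl nt]; apply: nf.
exists (conj_class f); last exact: conj_class_refl.
by split; [exists f|exact: not_haar_null_conj_class].
Qed.
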